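(* Let $N\ge 3$ be an integer. Consider closed polygonal curves in $\mathbb{R}^2$ with $N$ corners, i.e. sequences of $N$ distinct points $p_1,\dots,p_N\in\mathbb{R}^2$ together with the $N$ closed straight line-segments $[p_1,p_2],[p_2,p_3],\dots,[p_{N-1},p_N],[p_N,p_1]$, subject to the condition that any two of these line-segments intersect in at most one point. For such a curve, let $R$ be the number of bounded connected components of the complement in $\mathbb{R}^2$ of the union of the $N$ line-segments. Then the maximum of $R$ over all such curves equals $$f(N)=\begin{cases}\tfrac12 N^2-2N+2, & N \text{ even},\\[2pt] \tfrac12 N^2-\tfrac32 N+1, & N \text{ odd}.\end{cases}$$
   Context: Such a closed polygonal curve is a straight-line drawing of the $N$-cycle graph $p_1-p_2-\cdots-p_N-p_1$ in the plane in which line-segments are allowed to cross. The unbounded component of the complement is not counted in $R$. *)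

(* Defs.v *)
From HB Require Import structures.
From mathcomp Require Import all_boot all_order all_algebra.
From mathcomp Require Import all_classical all_reals all_analysis.
From mathcomp Require Import Rstruct Rstruct_topology.
From Stdlib Require Import Rdefinitions.
Set Implicit Arguments. Unset Strict Implicit. Unset Printing Implicit Defensive.
Import Order.TTheory GRing.Theory Num.Theory.
Local Open Scope classical_set_scope.
Local Open Scope ring_scope.

Definition pt := (R * R)%type.

Definition segment (a b : pt) : set pt :=
  [set x | exists t : R, 0 <= t <= 1 /\
     x = (a.1 + t * (b.1 - a.1), a.2 + t * (b.2 - a.2))].

Definition nexti (N : nat) (i : 'I_N) : 'I_N := ordS i.

Definition side (N : nat) (p : 'I_N -> pt) (i : 'I_N) : set pt :=
  segment (p i) (p (nexti i)).

Definition admissible (N : nat) (p : 'I_N -> pt) : Prop :=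
  injective p /\
  forall i j : 'I_N, i <> j ->
    forall x y : pt, side p i x -> side p j x -> side p i y -> side p j y -> x = y.

Definition curve (N : nat) (p : 'I_N -> pt) : set pt :=
  \bigcup_(i in [set: 'I_N]) side p i.

Definition bounded_pt (S : set pt) : Prop :=
  exists M : R, forall x, S x -> `|x.1| <= M /\ `|x.2| <= M.

Definition bounded_components (N : nat) (p : 'I_N -> pt) : set (set pt) :=
  [set C | exists x, (~` curve p) x /\
     C = connected_component (~` curve p) x /\ bounded_pt C].

Definition has_card (T : Type) (S : set T) (k : nat) : Prop :=
  exists f : 'I_k -> T, injective f /\ f @` setT = S.

Local Close Scope ring_scope.
Definition fmax (N : nat) : nat :=
  (if odd N then (N * N - 3 * N) %/ 2 + 1
   else (N * N) %/ 2 + 2 - 2 * N)%N.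

(* Main.v *)
(* Adding the sides one at a time, a new side s, which starts on the connected
   union K of the previous ones, raises the number of components of the
   complement by at most |s /\ K| - 1: a slit joining two points of K cuts a
   component into at most two pieces, and a slit with a free end does not cut it.
   As two sides have at most one common point, at most (N - 1)(N - 2)/2 bounded
   components arise, less the number of pairs of sides which bring no new point.
   When N is even, say that a side is full if it meets all the others and contains
   no corner but its own ends. The corners then alternate on both sides of its
   line, and the sign of this alternation is opposite for any two full sides:
   at most two sides are full, and at least N/2 - 1 pairs are lost.

   Conversely, a common point q of sides j and i, with j + 1 < i, closes the part
   q, p_(j+1), ..., p_i of the curve into a loop. If no three sides are concurrent,
   the crossing parities of these loops are functions on the complement, locally
   constant, zero far away, and linearly independent over F_2, as is seen by
   crossing the curve just before the last of these points on the side of largest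
   index. So there are at least as many bounded components as such points. Curves
   with the right number of them are obtained from lines tangent to a conic, as
   zigzags between two vertical lines. *)
Require Import Defs.
From mathcomp Require Import all_boot all_order all_algebra.
From mathcomp Require Import all_classical all_reals all_analysis.
From mathcomp Require Import Rstruct Rstruct_topology.
From mathcomp Require Import ring lra zify.
From Stdlib Require Import Rdefinitions.
Set Implicit Arguments. Unset Strict Implicit. Unset Printing Implicit Defensive.
Import Order.TTheory GRing.Theory Num.Theory.
Import numFieldNormedType.Exports.
Local Open Scope classical_set_scope.
Local Open Scope ring_scope.
(* The classical reals bring their own scopes for [R] and [%N]. *)
Bind Scope ring_scope with Rdefinitions.R.
Delimit Scope nat_scope with N.

(** * Segments and components in the plane *)

Section plane_topology.
Implicit Types (a b c l x y z w : pt) (d e m s t u v : R).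

(** Open squares serve as basic neighbourhoods, spelt as four linear inequalities that [lra] can
    use. *)
Definition box (e : R) (x y : pt) : Prop :=
  [/\ x.1 - e < y.1, y.1 < x.1 + e, x.2 - e < y.2 & y.2 < x.2 + e].

Lemma nbhs_box (x : pt) (A : set pt) :
  nbhs x A <-> exists2 e : R, 0 < e & forall y, box e x y -> A y.
Proof.
split.
  move=> /nbhs_ballP[e /= e0 H]; exists e => // y [h1 h2 h3 h4]; apply: H.
  by split; rewrite /ball /= ltr_norml; apply/andP; split; lra.
case=> e e0 H; apply/nbhs_ballP; exists e => //= y [].
rewrite /ball /= !ltr_norml => /andP[h1 h2] /andP[h3 h4].
by apply: H; split; lra.
Qed.

Lemma box_self e x : 0 < e -> box e x x.
Proof. by move=> e0; split; lra. Qed.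

Lemma box_sub e e' x y : e' <= e -> box e' x y -> box e x y.
Proof. by move=> h [? ? ? ?]; split; lra. Qed.

Lemma box_inner e x y : box e x y ->
  exists2 d : R, 0 < d & forall z, box d y z -> box e x z.
Proof.
move=> [h1 h2 h3 h4].
exists (Num.min (Num.min (y.1 - x.1 + e) (x.1 + e - y.1))
                (Num.min (y.2 - x.2 + e) (x.2 + e - y.2))).
  by rewrite !lt_min; apply/andP; split; apply/andP; split; lra.
set d := Num.min _ _.
have [d1 d2] : d <= y.1 - x.1 + e /\ d <= x.1 + e - y.1.
  by split; rewrite /d !ge_min lexx ?orbT.
have [d3 d4] : d <= y.2 - x.2 + e /\ d <= x.2 + e - y.2.
  by split; rewrite /d !ge_min lexx ?orbT.
by move=> z [? ? ? ?]; split; lra.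
Qed.

Lemma closed_avoid_box (K : set pt) x : closed K -> ~ K x ->
  exists2 e : R, 0 < e & forall y, box e x y -> ~ K y.
Proof.
move=> cK Kx; apply/nbhs_box.
by have := closed_openC cK; rewrite openE => /(_ x Kx).
Qed.

Lemma conv_gt (m a b t : R) : 0 <= t <= 1 -> m < a -> m < b -> m < a + t * (b - a).
Proof.
move=> /andP[t0 t1] ma mb; case: (leP a b) => ab; first by nra.
suff : b - a <= t * (b - a) by move=> ?; lra.
by nra.
Qed.

Lemma conv_lt (m a b t : R) : 0 <= t <= 1 -> a < m -> b < m -> a + t * (b - a) < m.
Proof.
move=> h am bm.
have : - m < - a + t * (- b - - a) by apply: conv_gt => //; lra.
by lra.
Qed.

Lemma box_convex e x y z w : box e x y -> box e x z -> segment y z w -> box e x w.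
Proof.
move=> [h1 h2 h3 h4] [g1 g2 g3 g4] [t [t01 ->]].
by split => /=; [apply: conv_gt|apply: conv_lt|apply: conv_gt|apply: conv_lt].
Qed.

(** The points of [C] near which [P] holds on [C] form an open set, and so do those near which it
    fails; local constancy makes the two complementary in [C]. *)
Lemma locally_const_connected (C : set pt) (P : pt -> Prop) :
  connected C ->
  (forall z, C z -> exists2 e : R, 0 < e &
     forall z', C z' -> box e z z' -> (P z' <-> P z)) ->
  forall x y, C x -> C y -> P x -> P y.
Proof.
move=> cC loc x y Cx Cy Px.
pose O (Q : pt -> Prop) := [set z | exists2 e : R, 0 < e &
   forall w, box e z w -> C w -> Q w].
have oO Q : open (O Q).
  rewrite openE => z [e e0 H]; apply/nbhs_box; exists e => // w /box_inner[d d0 D].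
  by exists d => // u /D; exact: H.
suff E : C `&` P = C by have [] : (C `&` P) y by rewrite E.
apply: cC; first by exists x.
  exists (O P); first exact: oO.
  apply/seteqP; split=> z [Cz Pz]; split=> //.
    have [e e0 H] := loc z Cz; exists e => // w zw Cw.
    by apply/(H w).
  by case: Pz => e e0 H; exact: (H z (box_self _ e0) Cz).
exists (~` O (fun w => ~ P w)); first exact: open_closedC.
apply/seteqP; split=> z [Cz Pz]; split=> //.
  by case=> e e0 H; exact: (H z (box_self _ e0) Cz).
have [e e0 H] := loc z Cz.
apply: contrapT => nPz; apply: Pz; exists e => // w zw Cw Pw.
by apply: nPz; apply/(H w).
Qed.

(* The normed structure lives on [R^o], to which [R] is convertible. *)
Lemma affine_continuous (u v : R) : continuous (fun s : R^o => u + s * (v - u) : R^o).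
Proof.
by move=> t; apply: cvgD; [exact: cvg_cst|apply: cvgM; [exact: cvg_id|exact: cvg_cst]].
Qed.

Lemma segment_image (a b : pt) : segment a b =
   (fun t : R^o => (a.1 + t * (b.1 - a.1), a.2 + t * (b.2 - a.2)) : pt) @` `[0, 1].
Proof.
apply/seteqP; split=> x.
  by case=> t [t01 ->]; exists t.
by case=> t /= t01 <-; exists t; split=> //; rewrite in_itv in t01.
Qed.

Lemma segment_continuous (a b : pt) : continuous
   (fun t : R^o => (a.1 + t * (b.1 - a.1), a.2 + t * (b.2 - a.2)) : pt).
Proof.
move=> t A [[B C] [/= hB hC] BCA].
have hB' := @affine_continuous a.1 b.1 t _ hB.
have hC' := @affine_continuous a.2 b.2 t _ hC.
have hBC : \forall s \near (t : R^o), B (a.1 + s * (b.1 - a.1)) /\ C (a.2 + s * (b.2 - a.2)).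
  exact: (@filterI _ (nbhs (t : R^o)) _ _ _ hB' hC').
move: hBC; apply: filterS => s [sB sC]; exact: (BCA (_, _)).
Qed.

Lemma segment_connected_pt (a b : pt) : connected (segment a b).
Proof.
have c01 : @connected R^o `[0, 1] by exact: segment_connected.
rewrite segment_image; apply: (connected_continuous_connected c01).
by apply: continuous_subspaceT => t; exact: segment_continuous.
Qed.

Lemma segment_closed_pt (a b : pt) : closed (segment a b).
Proof.
have hT : hausdorff_space (R^o * R^o)%type by exact: norm_hausdorff.
apply: (compact_closed hT).
have c01 : @compact R^o `[0, 1] by exact: segment_compact.
rewrite segment_image; apply: (continuous_compact _ c01).
by apply: continuous_subspaceT => t; exact: segment_continuous.
Qed.

(** This also says that both points lie off [K], since a point of [K] has an empty component
    here. *)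
Definition conn (K : set pt) (x y : pt) : Prop := connected_component (~` K) x y.

Lemma conn_refl K x : ~ K x -> conn K x x.
Proof. exact: connected_component_refl. Qed.

Lemma conn_sym K x y : conn K x y -> conn K y x.
Proof. exact: connected_component_sym. Qed.

Lemma conn_trans K y x z : conn K x y -> conn K y z -> conn K x z.
Proof. exact: connected_component_trans. Qed.

Lemma conn_avoid K x y : conn K x y -> ~ K y.
Proof. exact: connected_component_sub. Qed.

Lemma segment_left a b : segment a b a.
Proof. by exists 0; split; [rewrite lexx ler01|rewrite !mul0r !addr0; case: a]. Qed.

Lemma segment_right a b : segment a b b.
Proof.
exists 1; split; first by rewrite lexx ler01.
by case: a b => [a1 a2] [b1 b2] /=; congr pair; lra.
Qed.

Lemma conn_segment K x y : (forall z, segment x y z -> ~ K z) -> conn K x y.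
Proof.
move=> H; exists (segment x y); last exact: segment_right.
by split=> //; [exact: segment_left|exact: segment_connected_pt].
Qed.

Lemma segmentC a b : segment a b = segment b a.
Proof.
suff H (p q : pt) : segment p q `<=` segment q p by apply/seteqP; split; exact: H.
move=> x [t [/andP[t0 t1] ->]]; exists (1 - t); split; first by lra.
by congr pair; lra.
Qed.

(** Runs through the whole line of [a] and [b]; the segment is the part with [t] in [0, 1]. *)
Definition gam (a b : pt) (t : R) : pt :=
  (a.1 + t * (b.1 - a.1), a.2 + t * (b.2 - a.2)).

(** Twice the signed area of the triangle [a], [b], [x]: positive when [x] lies to the left of the
    line from [a] to [b]. *)
Definition orient (a b x : pt) : R :=
  (b.1 - a.1) * (x.2 - a.2) - (b.2 - a.2) * (x.1 - a.1).

Lemma gam_inj a b t u : a <> b -> gam a b t = gam a b u -> t = u.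
Proof.
case: a b => [a1 a2] [b1 b2] ab [/= h1 h2].
case: (eqVneq t u) => // tu; exfalso; apply: ab.
have tu0 : t - u != 0 by rewrite subr_eq0.
congr pair.
  by apply/eqP; rewrite -subr_eq0 -(mulrI_eq0 _ (mulfI tu0)); apply/eqP; lra.
by apply/eqP; rewrite -subr_eq0 -(mulrI_eq0 _ (mulfI tu0)); apply/eqP; lra.
Qed.

Lemma gam_segment a b t : 0 <= t <= 1 -> segment a b (gam a b t).
Proof. by move=> h; exists t. Qed.

Lemma gam_sub a b t u x : segment (gam a b t) (gam a b u) x ->
  exists s, [/\ x = gam a b s, Num.min t u <= s & s <= Num.max t u].
Proof.
case=> s [/andP[s0 s1] ->]; exists (t + s * (u - t)); split.
- by rewrite /gam /=; congr pair; lra.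
- by rewrite ge_min; case: (leP t u) => h; apply/orP; [left|right]; nra.
- by rewrite le_max; case: (leP t u) => h; apply/orP; [right|left]; nra.
Qed.

Lemma orient0_gam a b x : a <> b -> orient a b x = 0 -> exists t, x = gam a b t.
Proof.
case: a b x => [a1 a2] [b1 b2] [x1 x2] ab; rewrite /orient /gam /= => h.
case: (eqVneq a1 b1) => [e1|n1].
  have n2 : b2 - a2 != 0.
    by rewrite subr_eq0; apply/eqP => e2; apply: ab; rewrite e1 e2.
  exists ((x2 - a2) / (b2 - a2)); congr pair; last by field.
  have h' : (b1 - a1) * (x2 - a2) = 0 by rewrite e1 subrr mul0r.
  move/eqP: h; rewrite h' sub0r oppr_eq0.
  by rewrite mulf_eq0 (negbTE n2) /= -e1 subrr mulr0 => /eqP ?; lra.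
have n2 : b1 - a1 != 0 by rewrite subr_eq0 eq_sym.
exists ((x1 - a1) / (b1 - a1)); congr pair; first by field.
have : x2 - a2 = (b2 - a2) * (x1 - a1) / (b1 - a1).
  by apply: (canRL (mulfK n2)); lra.
by rewrite [_ / _ * _]mulrC mulrA => <-; lra.
Qed.

Lemma orient_gam a b t : orient a b (gam a b t) = 0.
Proof. by rewrite /orient /gam /=; ring. Qed.

Lemma orient_affine a b x y t :
  orient a b (gam x y t) = orient a b x + t * (orient a b y - orient a b x).
Proof. by rewrite /orient /gam /=; ring. Qed.

End plane_topology.

(** * The two sides of a slit and its free end *)

Section slits.
Implicit Types (a b c l x y z w : pt) (d e m s t u v : R).

Lemma gam0 a b : gam a b 0 = a.
Proof. by case: a => a1 a2; rewrite /gam /= !mul0r !addr0. Qed.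

Lemma gam1 a b : gam a b 1 = b.
Proof. by case: a b => [a1 a2] [b1 b2]; rewrite /gam /=; congr pair; lra. Qed.

Lemma gam_near a b t e : 0 < e ->
  exists2 m : R, 0 < m & forall u, `|u - t| < m -> box e (gam a b t) (gam a b u).
Proof.
move=> e0; pose D := 1 + `|b.1 - a.1| + `|b.2 - a.2|.
have D0 : 0 < D by have := normr_ge0 (b.1 - a.1); have := normr_ge0 (b.2 - a.2); rewrite /D; lra.
exists (e / D); first exact: divr_gt0.
move=> u h; have hD (d : R) : `|d| <= D -> `|(u - t) * d| < e.
  move=> dD; rewrite normrM; apply: (@le_lt_trans _ _ (`|u - t| * D)).
    exact: ler_wpM2l.
  by rewrite -ltr_pdivlMr.
have := hD (b.1 - a.1); rewrite ltr_norml => /(_ _)/andP[|h1 h2].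
  by have := normr_ge0 (b.2 - a.2); rewrite /D; lra.
have := hD (b.2 - a.2); rewrite ltr_norml => /(_ _)/andP[|h3 h4].
  by have := normr_ge0 (b.1 - a.1); rewrite /D; lra.
by split; rewrite /gam /=; lra.
Qed.

Lemma gam_near_inv a b t m : a <> b -> 0 < m ->
  exists2 e : R, 0 < e & forall u, box e (gam a b t) (gam a b u) -> `|u - t| < m.
Proof.
case: a b => [a1 a2] [b1 b2] ab m0.
have key (d y z : R) u : d != 0 -> y = z + (u - t) * d -> z - m * `|d| < y ->
    y < z + m * `|d| -> `|u - t| < m.
  move=> d0 -> h1 h2; have d1 : 0 < `|d| by rewrite normr_gt0.
  by rewrite -(ltr_pM2r d1) -normrM ltr_norml; apply/andP; split; lra.
case: (eqVneq b1 a1) => [e1|n1].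
  have n2 : b2 - a2 != 0.
    by rewrite subr_eq0; apply/eqP => e2; apply: ab; rewrite e1 e2.
  exists (m * `|b2 - a2|); first by rewrite mulr_gt0 ?normr_gt0.
  by move=> u [_ _ h1 h2]; apply: (key _ _ _ u n2 _ h1 h2) => /=; lra.
have n2 : b1 - a1 != 0 by rewrite subr_eq0.
exists (m * `|b1 - a1|); first by rewrite mulr_gt0 ?normr_gt0.
by move=> u [h1 h2 _ _]; apply: (key _ _ _ u n2 _ h1 h2) => /=; lra.
Qed.

Lemma segment_orient a b x : segment a b x -> orient a b x = 0.
Proof. by case=> t [_ ->]; exact: orient_gam. Qed.

Lemma side_point a b z e s : a <> b -> orient a b z = 0 -> 0 < e ->
  s = 1 \/ s = -1 -> exists2 x, box e z x & 0 < s * orient a b x.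
Proof.
move=> ab z0 e0 hs; pose D := 1 + `|b.1 - a.1| + `|b.2 - a.2|.
have D0 : 0 < D by have := normr_ge0 (b.1 - a.1); have := normr_ge0 (b.2 - a.2); rewrite /D; lra.
pose h := s * (e / D).
have hD (d : R) : `|d| < D -> - e < h * d /\ h * d < e.
  move=> dD; suff : `|h * d| < e by rewrite ltr_norml => /andP.
  have -> : e = e / D * D by rewrite divfK // gt_eqF.
  have s1 : `|s| = 1 by case: hs => ->; rewrite ?normrN normr1.
  rewrite !normrM s1 mul1r; have eD : 0 < e / D by exact: divr_gt0.
  by rewrite -normrM (gtr0_norm eD) ltr_pM2l.
have [h1 h2] : - e < h * (b.1 - a.1) /\ h * (b.1 - a.1) < e.
  by apply: hD; have := normr_ge0 (b.2 - a.2); rewrite /D; lra.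
have [h3 h4] : - e < h * (b.2 - a.2) /\ h * (b.2 - a.2) < e.
  by apply: hD; have := normr_ge0 (b.1 - a.1); rewrite /D; lra.
(* The point [z] is displaced along the normal of the line, by an amount that [D] keeps inside the
   box. *)
exists (z.1 - h * (b.2 - a.2), z.2 + h * (b.1 - a.1)); first by split => /=; lra.
have -> : s * orient a b (z.1 - h * (b.2 - a.2), z.2 + h * (b.1 - a.1)) =
    s * orient a b z + (s * s) * (e / D) * ((b.1 - a.1) ^+ 2 + (b.2 - a.2) ^+ 2).
  by rewrite /orient /h /=; ring.
have -> : s * s = 1 by case: hs => ->; rewrite ?mulrNN mulr1.
rewrite z0 mulr0 add0r mul1r; apply: mulr_gt0; first exact: divr_gt0.
rewrite lt0r addr_ge0 ?sqr_ge0 // andbT paddr_eq0 ?sqr_ge0 // !sqrf_eq0 !subr_eq0.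
apply/negP => /andP[/eqP e1 /eqP e2]; apply: ab.
by case: (a) (b) e1 e2 => [? ?] [? ?] /= -> ->.
Qed.

Lemma interior_box K a b t : closed K -> a <> b -> 0 < t < 1 -> ~ K (gam a b t) ->
  exists2 e : R, 0 < e & forall x, box e (gam a b t) x ->
    ~ K x /\ (orient a b x = 0 -> segment a b x).
Proof.
move=> cK ab /andP[t0 t1] Kt; have [e1 e10 h1] := closed_avoid_box cK Kt.
pose m := Num.min t (1 - t).
have m0 : 0 < m by rewrite lt_min; apply/andP; split; lra.
have mt : m <= t by rewrite ge_min lexx.
have mt' : m <= 1 - t by rewrite ge_min lexx orbT.
have [e2 e20 h2] := @gam_near_inv a b t _ ab m0.
exists (Num.min e1 e2); first by rewrite lt_min e10.
move=> x xb; split; first by apply: h1; apply: box_sub xb; rewrite ge_min lexx.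
move=> /(orient0_gam ab)[u xu]; rewrite xu in xb *; apply: gam_segment.
have : box e2 (gam a b t) (gam a b u) by apply: box_sub xb; rewrite ge_min lexx orbT.
by move/h2; rewrite ltr_norml => /andP[? ?]; lra.
Qed.

Section slit.
Variables (K : set pt) (a b : pt).
Hypotheses (cK : closed K) (ab : a <> b)
  (avoid : forall t : R, 0 < t < 1 -> ~ K (gam a b t)).
Let K' := K `|` segment a b.

(** The half of a small box strictly on one side of the line is convex and misses both [K] and the
    segment. *)
Lemma half_box_conn t s : 0 < t < 1 -> exists2 e : R, 0 < e & forall x y,
  box e (gam a b t) x -> box e (gam a b t) y ->
  0 < s * orient a b x -> 0 < s * orient a b y -> conn K' x y.
Proof.
move=> t01; have [e e0 h] := interior_box cK ab t01 (avoid t01).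
exists e => // x y xb yb xs ys; apply: conn_segment => z zxy [Kz|/segment_orient z0].
  by have [] := h z (box_convex xb yb zxy).
case: zxy z0 => u [u01 ->] z0.
have h1 : 0 < s * orient a b x + u * (s * orient a b y - s * orient a b x) by exact: conv_gt.
have := orient_affine a b x y u; rewrite /gam z0 => /(congr1 ( *%R s)) h2.
by move: h1; rewrite -!mulrBr [u * _]mulrCA -mulrDr -h2 mulr0 ltxx.
Qed.

(** Half boxes at neighbouring points of the open segment overlap. Hence lying next to the component
    of [l] is a locally constant property along the segment, and it spreads from the midpoint to
    every [t]. *)
Lemma one_sided_tube s : s = 1 \/ s = -1 -> exists l, forall t, 0 < t < 1 ->
  exists2 e : R, 0 < e & forall x, box e (gam a b t) x -> 0 < s * orient a b x -> conn K' l x.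
Proof.
move=> hs.
have half : 0 < (2^-1 : R) < 1 by apply/andP; split; lra.
have [e0 e00 h0] := half_box_conn s half.
have [l lb ls] := side_point ab (orient_gam a b 2^-1) e00 hs.
exists l => t t01.
pose P z := exists2 e : R, 0 < e & forall x, box e z x -> 0 < s * orient a b x -> conn K' l x.
have in01 z : segment (gam a b 2^-1) (gam a b t) z -> exists2 u, 0 < u < 1 & z = gam a b u.
  case/gam_sub => u [-> h1 h2]; exists u => //.
  move: h1 h2 t01; rewrite ge_min le_max.
  by move=> /orP[] ? /orP[] ? /andP[? ?]; apply/andP; split; lra.
apply: (@locally_const_connected _ P (@segment_connected_pt (gam a b 2^-1) (gam a b t)) _
  (gam a b 2^-1)) (segment_left _ _) (segment_right _ _) _; last first.
  by exists e0 => // x xb; exact: h0.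
move=> z zC; have [u u01 zu] := in01 z zC.
have [e ep h] := half_box_conn s u01; rewrite -zu in h.
have z0 : orient a b z = 0 by rewrite zu orient_gam.
have [y yb ys] := side_point ab z0 ep hs.
have key z' : segment (gam a b 2^-1) (gam a b t) z' -> box e z z' -> P z' <-> conn K' l y.
  move=> /in01[u' _ zu'] zz'.
  have z'0 : orient a b z' = 0 by rewrite zu' orient_gam.
  have [d d0 hd] := box_inner zz'; split.
    case=> e' e'0 H; have m0 : 0 < Num.min d e' by rewrite lt_min d0.
    have [x xb xs] := side_point ab z'0 m0 hs.
    apply: (@conn_trans _ x); first by apply: H => //; apply: box_sub xb; rewrite ge_min lexx orbT.
    by apply: h => //; apply: hd; apply: box_sub xb; rewrite ge_min lexx.
  move=> ly; exists d => // x /hd xb xs; apply: (conn_trans ly); exact: h.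
exists e => // z' z'C zz'; rewrite (key z') // (key z) //; exact: box_self.
Qed.

(** Near a free end [b], the box without the slit is star-shaped about a point [c] of the line
    slightly beyond [b]. So it lies in one component, which the tube along either side reaches. *)
Lemma slit_end s l : s = 1 \/ s = -1 -> ~ K b ->
  (forall t, 0 < t < 1 -> exists2 e : R, 0 < e &
    forall x, box e (gam a b t) x -> 0 < s * orient a b x -> conn K' l x) ->
  exists2 e : R, 0 < e & forall x, box e b x -> ~ segment a b x -> conn K' l x.
Proof.
move=> hs Kb tube; have [e1 e10 h1] := closed_avoid_box cK Kb.
(* In this box, points of the line have positive parameters, so that those off the segment lie
   beyond [b]. *)
have [e2 e20 h2] := @gam_near_inv a b 1 1 ab ltr01; rewrite gam1 in h2.
pose e := Num.min e1 e2; have e0 : 0 < e by rewrite lt_min e10.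
have ee1 : e <= e1 by rewrite ge_min lexx.
have ee2 : e <= e2 by rewrite ge_min lexx orbT.
have [m m0 hm] := gam_near a b 1 e0; rewrite gam1 in hm.
pose c := gam a b (1 + m / 2).
have bc : box e b c by apply: hm; rewrite addrAC subrr add0r gtr0_norm; lra.
have star x : box e b x -> ~ segment a b x -> conn K' x c.
  move=> xb nx; apply: conn_segment => z zxc [|zab].
    by apply: h1; apply: (box_sub ee1); exact: box_convex xb bc zxc.
  have [v [v01 zv]] := zab.
  case: (eqVneq (orient a b x) 0) => [/(orient0_gam ab)[u xu]|x0].
    move: zxc; rewrite xu => /gam_sub[w [zw w1 w2]].
    have wv : w = v by apply: (gam_inj ab); rewrite -zw zv.
    have : ~~ (0 <= u <= 1) by apply/negP => u01; apply: nx; rewrite xu; exact: gam_segment.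
    have : box e2 b (gam a b u) by rewrite -xu; exact: box_sub xb.
    move/h2; rewrite ltr_norml => /andP[u1 u2].
    have -> : 0 <= u by lra.
    rewrite /= -ltNge => u3; move: w1; rewrite ge_min.
    by case/andP: v01 => ? ? /orP[] ?; lra.
  have [w [w01 zw]] := zxc; have := orient_affine a b x c w.
  rewrite /gam -zw (segment_orient zab) [orient a b c]orient_gam sub0r => E.
  have w1 : w = 1.
    by apply/eqP; rewrite -subr_eq0 -(mulIr_eq0 _ (mulIf x0)); apply/eqP; lra.
  have cv : c = gam a b v by rewrite -(gam1 x c) -w1; move: zw; rewrite zv /gam => <-.
  have := gam_inj ab cv; case/andP: v01 => ? ? ?; lra.
have lc : conn K' l c.
  pose t := Num.max (1 - m / 2) 2^-1.
  have tm : 1 - m / 2 <= t by rewrite le_max lexx.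
  have t2 : 2^-1 <= t by rewrite le_max lexx orbT.
  have t1 : t < 1 by rewrite gt_max; apply/andP; split; lra.
  have t01 : 0 < t < 1 by apply/andP; split; lra.
  have [e' e'0 H] := tube t t01.
  have bt : box e b (gam a b t) by apply: hm; rewrite ltr_norml; apply/andP; split; lra.
  have [d d0 hd] := box_inner bt.
  have q0 : 0 < Num.min d e' by rewrite lt_min d0.
  have [x xb xs] := side_point ab (orient_gam a b t) q0 hs.
  apply: (@conn_trans _ x); first by apply: H => //; apply: box_sub xb; rewrite ge_min lexx orbT.
  apply: star; first by apply: hd; apply: box_sub xb; rewrite ge_min lexx.
  by move/segment_orient => x0; rewrite x0 mulr0 ltxx in xs.
exists e => // x xb nx; apply: (conn_trans lc); apply: conn_sym; exact: star.
Qed.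

End slit.

End slits.

(** * Growth of the number of components when a segment is added *)

Section covering_lists.
Implicit Types (a b c x y z w : pt) (d e m s t u v : R).

(** The list meets every component of the complement, possibly more than once, so that its size
    bounds their number without any prior finiteness. *)
Definition covers (K : set pt) (l : seq pt) : Prop :=
  forall x, ~ K x -> exists2 y, y \in l & conn K x y.

Section adding_a_segment.
Variables (K : set pt) (a b : pt).
Hypotheses (cK : closed K) (ab : a <> b)
  (avoid : forall t, 0 < t < 1 -> ~ K (gam a b t)).
Let K' := K `|` segment a b.
Let mid := gam a b 2^-1.

Lemma mid_avoid : ~ K mid.
Proof. by apply: avoid; apply/andP; split; lra. Qed.

(** On the component of [mid], lying on the slit or being joined to one of its two sides is a
    locally constant property. Around a free end [b] the two sides are joined. *)
Lemma two_sides : exists l r,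
  (forall x, conn K mid x -> segment a b x \/ conn K' l x \/ conn K' r x) /\
  (~ K b -> conn K' l r).
Proof.
have [l hl] := one_sided_tube cK ab avoid (or_introl (erefl 1)).
have [r hr] := one_sided_tube cK ab avoid (or_intror (erefl (-1))).
have ba : b <> a by move=> E; apply: ab.
have rev t : gam b a t = gam a b (1 - t) by rewrite /gam; congr pair; lra.
(* The end [a] is treated as the end of the reversed segment, which exchanges left and right. *)
have start s p : s = 1 \/ s = -1 -> ~ K a -> (forall t, 0 < t < 1 -> exists2 e : R, 0 < e &
      forall x, box e (gam a b t) x -> 0 < s * orient a b x -> conn K' p x) ->
    exists2 e : R, 0 < e & forall x, box e a x -> ~ segment a b x -> conn K' p x.
  move=> hs Ka H; rewrite /K' segmentC; apply: (slit_end cK ba (s := - s)) => //.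
    by case: hs => ->; [right|left; rewrite opprK].
  move=> t /andP[? ?]; have [|e e0 h] := H (1 - t); first by apply/andP; split; lra.
  exists e => // x; rewrite rev -segmentC => xb xs; apply: h => //.
  by have -> : s * orient a b x = - s * orient b a x by rewrite /orient; ring.
exists l, r; split; last first.
  move=> Kb; have [e1 e10 h1] := slit_end cK ab (or_introl (erefl 1)) Kb hl.
  have [e2 e20 h2] := slit_end cK ab (or_intror (erefl (-1))) Kb hr.
  pose e := Num.min e1 e2; have e0 : 0 < e by rewrite lt_min e10.
  have [m m0 hm] := gam_near a b 1 e0; rewrite gam1 in hm.
  have bx : box e b (gam a b (1 + m / 2)) by apply: hm; rewrite addrAC subrr add0r gtr0_norm; lra.
  have nx : ~ segment a b (gam a b (1 + m / 2)).
    move=> [v [/andP[_ v1] /(gam_inj ab) hv]]; move: v1; rewrite -hv.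
    by apply/negP; rewrite -ltNge; lra.
  apply: conn_trans (h1 _ _ nx) (conn_sym (h2 _ _ nx)); apply: box_sub bx.
    by rewrite ge_min lexx.
  by rewrite ge_min lexx orbT.
pose P z := segment a b z \/ conn K' l z \/ conn K' r z.
have Pseg z : ~ K z -> segment a b z -> exists2 e : R, 0 < e & forall x, box e z x -> P x.
  move=> Kz [v [/andP[v0 v1] zv']]; have {zv'} zv : z = gam a b v := zv'.
  case: (eqVneq v 0) => [v00|vn0].
    have za : z = a by rewrite zv v00 gam0.
    rewrite za in Kz *; have [e e0 h] := start _ _ (or_introl (erefl 1)) Kz hl.
    by exists e => // x xb; case: (pselect (segment a b x)); [left|right; left; apply: h].
  case: (eqVneq v 1) => [v11|vn1].
    have zb : z = b by rewrite zv v11 gam1.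
    rewrite zb in Kz *.
    have [e e0 h] := slit_end cK ab (or_introl (erefl 1)) Kz hl.
    by exists e => // x xb; case: (pselect (segment a b x)); [left|right; left; apply: h].
  have v01 : 0 < v < 1 by rewrite !lt_neqAle vn1 v1 eq_sym vn0 v0.
  have [e1 e10 h1] := interior_box cK ab v01 (avoid v01).
  have [e2 e20 h2] := hl v v01; have [e3 e30 h3] := hr v v01.
  exists (Num.min e1 (Num.min e2 e3)); first by rewrite !lt_min e10 e20.
  rewrite zv => x xb.
  have xb1 : box e1 (gam a b v) x by apply: box_sub xb; rewrite !ge_min lexx.
  have xb2 : box e2 (gam a b v) x by apply: box_sub xb; rewrite !ge_min lexx ?orbT.
  have xb3 : box e3 (gam a b v) x by apply: box_sub xb; rewrite !ge_min lexx ?orbT.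
  have [_ h4] := h1 x xb1; rewrite /P.
  case: (ltgtP 0 (orient a b x)) => o.
  - by right; left; apply: h2; rewrite ?mul1r.
  - by right; right; apply: h3; rewrite // mulN1r oppr_gt0.
  - by left; apply: h4.
move=> x mx.
apply: (@locally_const_connected _ P (@component_connected _ (~` K) mid) _ mid) => //.
- move=> z /conn_avoid Kz; case: (pselect (segment a b z)) => [zs|zs].
    have [e e0 h] := Pseg z Kz zs; exists e => // z' _ zz'.
    by split=> _; apply: h => //; exact: box_self.
  have cK' : closed K' by apply: closedU => //; exact: segment_closed_pt.
  have [e e0 h] := closed_avoid_box (x := z) cK' (fun h => match h with or_introl p => Kz p
     | or_intror p => zs p end).
  exists e => // z' _ zz'.
  have zz : conn K' z z'.
    by apply: conn_segment => w /(box_convex (box_self z e0) zz'); exact: h.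
  have zs' : ~ segment a b z' by move=> p; apply: (h z' zz'); right.
  split; case=> // -[] q; right; [left|right|left|right].
  - exact: conn_trans q (conn_sym zz).
  - exact: conn_trans q (conn_sym zz).
  - exact: conn_trans q zz.
  - exact: conn_trans q zz.
- by apply: conn_refl; exact: mid_avoid.
- by left; apply: gam_segment; apply/andP; split; lra.
Qed.

(** A component that contains a point of the new segment contains [mid] as well, by moving along the
    segment; all other components are unaffected. *)
Lemma conn_away x y : ~ conn K mid x -> conn K x y -> conn K' x y.
Proof.
move=> nm [C [Cx CK cC] Cy]; exists C => //; split=> // z Cz [/(CK z Cz) //|zs].
apply: nm; apply: (@conn_trans _ z); last first.
  exists C => //; split => //.
apply: conn_segment => w; case: zs => v [/andP[v0 v1] zv].
have E : z = gam a b v := zv; rewrite E => /gam_sub[u [-> h1 h2]] Ku.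
case: (eqVneq u v) => [uv|nuv]; first by apply: (CK z Cz); rewrite E -uv.
apply: (@avoid u) => //; move: h1 h2 nuv; rewrite ge_min le_max neq_lt.
by move=> /orP[] h1 /orP[] h2 /orP[] h3; apply/andP; split; lra.
Qed.

(** The representative of the component of [mid] is replaced by one point for each side of the
    slit. *)
Lemma covers_add l : covers K l -> exists2 l', (size l' <= (size l).+1)%N & covers K' l'.
Proof.
move=> cov; have [p [q [hpq _]]] := two_sides; have [y yl my] := cov mid mid_avoid.
exists [:: p, q & rem y l].
  by rewrite /= size_rem //; case: l {cov} yl => //.
move=> x Kx; case: (pselect (conn K mid x)) => [mx|nmx].
  case: (hpq x mx) => [xs|[h|h]]; first by case: Kx; right.
    by exists p; [rewrite inE eqxx|exact: conn_sym].
  by exists q; [rewrite !inE eqxx orbT|exact: conn_sym].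
have [z zl xz] := cov x (fun h => Kx (or_introl h)).
exists z; last exact: conn_away.
have := perm_to_rem yl => /perm_mem/(_ z); rewrite zl inE => /esym/orP[/eqP zy|h].
  by case: nmx; rewrite zy in xz; exact: conn_trans my (conn_sym xz).
by rewrite !inE h !orbT.
Qed.

(** Both sides of the slit are joined around [b], so one new representative replaces the old one. *)
Lemma covers_add_dangling l : ~ K b -> covers K l ->
  exists2 l', (size l' <= size l)%N & covers K' l'.
Proof.
move=> Kb cov; have [p [q [hpq /(_ Kb) pq]]] := two_sides.
have [y yl my] := cov mid mid_avoid.
exists (p :: rem y l).
  by rewrite /= size_rem //; case: l {cov} yl => //.
move=> x Kx; case: (pselect (conn K mid x)) => [mx|nmx].
  case: (hpq x mx) => [xs|[h|h]]; first by case: Kx; right.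
    by exists p; [rewrite inE eqxx|exact: conn_sym].
  exists p; first by rewrite inE eqxx.
  by apply: conn_sym; exact: conn_trans pq h.
have [z zl xz] := cov x (fun h => Kx (or_introl h)).
exists z; last exact: conn_away.
have := perm_to_rem yl => /perm_mem/(_ z); rewrite zl inE => /esym/orP[/eqP zy|h].
  by case: nmx; rewrite zy in xz; exact: conn_trans my (conn_sym xz).
by rewrite !inE h !orbT.
Qed.

End adding_a_segment.

Lemma segment_split a b t : 0 <= t <= 1 ->
  segment a b = segment a (gam a b t) `|` segment (gam a b t) b.
Proof.
move=> /andP[t0 t1]; apply/seteqP; split=> x; last first.
  have sub p q : 0 <= p <= 1 -> 0 <= q <= 1 -> segment (gam a b p) (gam a b q) x -> segment a b x.
    move=> /andP[? ?] /andP[? ?] /gam_sub[u [-> h1 h2]]; apply: gam_segment.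
    by move: h1 h2; rewrite ge_min le_max => /orP[] ? /orP[] ?; apply/andP; split; lra.
  case=> h.
    by apply: (sub 0 t); rewrite ?gam0 // ?lexx ?ler01 ?t0.
  by apply: (sub t 1); rewrite ?gam1 // ?lexx ?ler01 ?t0.
case=> u [/andP[u0 u1] ->]; case: (leP u t) => ut.
  left; case: (eqVneq t 0) => [tz|tn].
    exists 0; split; first by rewrite lexx ler01.
    have -> : u = 0 by lra.
    by rewrite /= !mul0r.
  have t0' : 0 < t by rewrite lt0r tn.
  exists (u / t); split.
    by apply/andP; split; [exact: divr_ge0|rewrite ler_pdivrMr ?mul1r].
  rewrite /gam /=; congr pair; by field.
right; have t1' : 1 - t != 0 by rewrite gt_eqF // ; lra.
exists ((u - t) / (1 - t)); split.
  apply/andP; split; first by apply: divr_ge0; lra.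
  by rewrite ler_pdivrMr; lra.
rewrite /gam /=; congr pair; by field.
Qed.

Lemma min_in_seq (l : seq R) : l != [::] -> exists2 t, t \in l & forall u, u \in l -> t <= u.
Proof.
elim: l => // v l IH _; case: (eqVneq l [::]) => [->|/IH[t tl h]].
  by exists v; rewrite ?inE // => u; rewrite inE => /eqP ->.
case: (leP v t) => vt.
  exists v; rewrite ?inE ?eqxx // => u; rewrite inE => /orP[/eqP ->//|/h]; exact: le_trans.
exists t; rewrite ?inE ?tl ?orbT // => u; rewrite inE => /orP[/eqP ->|/h] //; exact: ltW.
Qed.

(** The segment is cut at its first meeting point with [K] after the start: that piece adds at most
    one component, and the rest is handled by induction. A last piece with a free end adds none.
    Parameter 0 is not charged, whence the gain of one over the number of meeting points for a
    segment that starts on [K]. *)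
Lemma covers_add_segment (K : set pt) a b (ts : seq R) (l : seq pt) :
  closed K -> a <> b ->
  (forall t, 0 < t <= 1 -> K (gam a b t) -> t \in ts) -> covers K l ->
  exists2 l', (size l' <= size l + size ts)%N & covers (K `|` segment a b) l'.
Proof.
have [n] := ubnP (size ts); elim: n => // n IH in K a ts l * => szts cK ab hts cov.
(* [ts] may contain other values; only the actual meeting parameters are kept. *)
pose S := [seq t <- ts | (0 < t <= 1) && `[< K (gam a b t) >]].
have inS t : 0 < t <= 1 -> K (gam a b t) -> t \in S.
  by move=> t01 Kt; rewrite mem_filter t01 hts // andbT; apply/asboolP.
case: (eqVneq S [::]) => [S0|Sn0].
  have [|Kb|l' sl' cl'] := @covers_add_dangling K a b cK ab _ l _ cov.
  - move=> t /andP[t0 t1] Kt.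
    by have := @inS t; rewrite S0 t0 (ltW t1) => /(_ isT Kt).
  - by have := @inS 1; rewrite S0 ltr01 lexx gam1 => /(_ isT Kb).
  - by exists l' => //; apply: (leq_trans sl'); exact: leq_addr.
have [t] := min_in_seq Sn0; rewrite mem_filter => /andP[/andP[t01 /asboolP Kt] tts] tmin.
have [t0 t1] := andP t01.
have tt : ts != [::] by apply/eqP => E; rewrite E in tts.
have avoid u : 0 < u < t -> ~ K (gam a b u).
  move=> /andP[u0 ut] Ku; have := tmin u (inS u _ Ku); rewrite u0 (ltW (lt_le_trans ut t1)).
  by move=> /(_ isT); rewrite leNgt ut.
have agt : a <> gam a b t.
  by move=> E; move: t0; rewrite (gam_inj ab (etrans (gam0 a b) E)) ltxx.
have comp1 u : gam a (gam a b t) u = gam a b (t * u) by rewrite /gam /=; congr pair; ring.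
have [|l1 sl1 cl1] := @covers_add K a (gam a b t) cK agt _ l cov.
  move=> u /andP[u0 u1]; rewrite comp1; apply: avoid; rewrite mulr_gt0 //=.
  by rewrite gtr_pMr.
case: (eqVneq t 1) => [t11|tn1].
  exists l1; last by rewrite t11 gam1 in cl1.
  by apply: (leq_trans sl1); rewrite -addn1 leq_add2l lt0n size_eq0.
have {t1}t1 : t < 1 by rewrite lt_neqAle tn1.
have comp2 u : gam (gam a b t) b u = gam a b (t + u * (1 - t)).
  by rewrite /gam /=; congr pair; ring.
have t1n : 1 - t != 0 by rewrite subr_eq0 eq_sym.
(* The remaining parameters are rescaled to the piece from [gam a b t] to [b]. *)
have [||||l2 sl2 cl2] := IH (K `|` segment a (gam a b t)) (gam a b t)
   [seq (s - t) / (1 - t) | s <- rem t ts] l1 _ _ _ _ cl1.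
- by rewrite size_map size_rem //; case: (ts) szts tt.
- by apply: closedU => //; exact: segment_closed_pt.
- by move=> E; move: t1; rewrite (gam_inj ab (etrans E (esym (gam1 a b)))) ltxx.
- move=> u /andP[u0 u1]; rewrite comp2.
  have tu : t < t + u * (1 - t) by rewrite ltrDl mulr_gt0 // subr_gt0.
  have tu1 : t + u * (1 - t) <= 1 by nra.
  case=> [Ku|[v [/andP[v0 v1] /esym]]]; last first.
    rewrite -/(gam a (gam a b t) v) comp1 => /(gam_inj ab) E.
    by move: tu; rewrite -E ltNge ler_piMr // ltW.
  apply/mapP; exists (t + u * (1 - t)); last by rewrite addrAC subrr add0r mulfK.
  have := hts _ _ Ku; rewrite tu1 (lt_trans t0 tu) => /(_ isT).
  rewrite (perm_mem (perm_to_rem tts)) inE => /orP[/eqP E|//].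
  by move: tu; rewrite E ltxx.
exists l2; last by rewrite (@segment_split a b t) ?(ltW t0) ?(ltW t1) // setUA.
apply: (leq_trans sl2); rewrite size_map size_rem //.
by move: sl1 szts tt; case: (ts) => //= *; lia.
Qed.

End covering_lists.

(** * The upper bound *)

Section adding_sides.
Implicit Types (a b c x y z w : pt) (d e m s t u v : R).

Lemma curve_bounded N (p : 'I_N -> pt) : exists M, forall x, curve p x ->
  [/\ - M < x.1, x.1 < M, - M < x.2 & x.2 < M].
Proof.
pose M := 1 + \sum_i (`|(p i).1| + `|(p i).2|).
have pM i : [/\ - M < (p i).1, (p i).1 < M, - M < (p i).2 & (p i).2 < M].
  have : `|(p i).1| + `|(p i).2| < M.
    rewrite /M (bigD1 i) //=.
    have : 0 <= \sum_(j < N | j != i) (`|(p j).1| + `|(p j).2|).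
      by apply: sumr_ge0 => j _; exact: addr_ge0.
    by move=> ?; lra.
  have h1 := normr_ge0 (p i).1; have h2 := normr_ge0 (p i).2 => h3.
  have /ltr_normlP[? ?] : `|(p i).1| < M by lra.
  have /ltr_normlP[? ?] : `|(p i).2| < M by lra.
  by split; lra.
exists M => x [i _ [t [t01 ->]]] /=.
have [a1 a2 a3 a4] := pM i; have [b1 b2 b3 b4] := pM (nexti i).
by split; [apply: conv_gt|apply: conv_lt|apply: conv_gt|apply: conv_lt].
Qed.

(* One of the components met by the list is unbounded, hence the gain of one. *)
Lemma bounded_components_card N (p : 'I_N -> pt) (l : seq pt) : covers (curve p) l ->
  exists k, has_card (bounded_components p) k /\ (k < size l)%N.
Proof.
move=> cov; have [M hM] := curve_bounded p.
have far t : 0 <= t -> ~ curve p (M + t, 0).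
  by move=> t0 /hM[_ /= h _ _]; move: h; apply/negP; rewrite -leNgt; lra.
have M0 : M = M + 0 by rewrite addr0.
have [|y0 y0l zy0] := cov (M, 0); first by rewrite M0; exact: far.
have unb : ~ bounded_pt (connected_component (~` curve p) y0).
  case=> B hB; have B0 := normr_ge0 B; have M0' := normr_ge0 M.
  have [] := hB (M + (`|B| + `|M| + 1), 0).
    apply: conn_trans (conn_sym zy0) _; apply: conn_segment => x [t [/andP[t0 t1] ->]] /=.
    rewrite (_ : (_, _) = (M + t * (`|B| + `|M| + 1), 0)).
      by apply: far; apply: mulr_ge0 => //; lra.
    by congr pair; ring.
  rewrite /= ler_norml => /andP[_ h1] _.
  have := ler_norm B; have := ler_norm (- M); rewrite normrN => ? ?.
  by move: h1; apply/negP; rewrite -ltNge; lra.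
pose L := undup [seq C <- [seq connected_component (~` curve p) y | y <- rem y0 l]
                | `[< bounded_components p C >]].
exists (size L); split; last first.
  apply: (leq_ltn_trans (size_undup _)); apply: (@leq_ltn_trans (size (rem y0 l))).
    by rewrite size_filter -(size_map (connected_component (~` curve p))) count_size.
  by rewrite size_rem //; case: l y0l {cov L}.
exists (fun i : 'I_(size L) => nth set0 L i); split.
  move=> i j /eqP; rewrite nth_uniq ?undup_uniq //; first by move/eqP/val_inj.
apply/seteqP; split=> C.
  case=> i _ <-; have : nth set0 L i \in L by exact: mem_nth.
  by rewrite mem_undup mem_filter => /andP[/asboolP].
move=> hC; have [x [Kx [Cx bC]]] := hC; have [y yl xy] := cov x Kx.
have Cy : C = connected_component (~` curve p) y.
  by rewrite Cx; exact: same_connected_component.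
have CL : C \in L.
  rewrite mem_undup mem_filter; apply/andP; split; first exact/asboolP.
  apply/mapP; exists y => //.
  move: yl; rewrite (perm_mem (perm_to_rem y0l)) inE => /orP[/eqP E|//].
  by case: unb; rewrite -E -Cy.
by rewrite -index_mem in CL; exists (Ordinal CL) => //=; rewrite nth_index // -index_mem.
Qed.

Section upper_bound.
Variables (N : nat) (p : 'I_N -> pt).
Hypotheses (N3 : (3 <= N)%N) (adm : admissible p).

(* The common point of a lost pair, if any, lies on an earlier side already, so
   that [j] brings no new point of [i]. *)
Definition lost (j i : 'I_N) : bool :=
  `[< ~ (side p j `&` side p i !=set0) \/
      exists2 k : 'I_N, (k < j)%N & side p k `&` side p j `&` side p i !=set0 >].

(** These sides correspond to the points of side [i] on earlier sides: each point is represented by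
    the first side through it. *)
Definition kept (i : 'I_N) : {set 'I_N} :=
  [set j : 'I_N | (j < i)%N && ~~ lost j i]%SET.

Let first_sides (n : nat) := [set x | exists2 i : 'I_N, (i < n)%N & side p i x].

Lemma side_unique i j x y : i <> j -> side p i x -> side p j x ->
  side p i y -> side p j y -> x = y.
Proof. by have [_ h] := adm => ij ? ? ? ?; apply: (h i j). Qed.

Lemma first_kept (i j : 'I_N) x : (j < i)%N -> side p i x -> side p j x ->
  (forall k : 'I_N, (k < j)%N -> ~ side p k x) -> j \in kept i.
Proof.
move=> ji ix jx jmin; rewrite inE ji; apply/asboolPn => -[]; first by apply; exists x.
case=> k kj [y [[ky jy] iy]]; apply: (jmin k kj).
by rewrite (@side_unique j i x y) // => E; rewrite E ltnn in ji.
Qed.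

Lemma first_side (n : nat) x : first_sides n x -> exists j : 'I_N, [/\ (j < n)%N, side p j x &
  forall k : 'I_N, (k < j)%N -> ~ side p k x].
Proof.
case=> i0 i0n i0x.
have P0 : `[< side p i0 x >] by exact/asboolP.
case: (@arg_minnP _ i0 (fun i => `[< side p i x >]) (fun i : 'I_N => i : nat) P0) => j /asboolP jx jmin.
exists j; split=> //; first by apply: leq_ltn_trans i0n; exact: jmin.
by move=> k kj /asboolP /jmin; rewrite leqNgt kj.
Qed.

Lemma next_neq i : p i <> p (nexti i).
Proof.
have [pinj _] := adm => /pinj /(congr1 val) /=.
have := ltn_ord i; rewrite leq_eqVlt => /orP[/eqP E|h].
  by rewrite E modnn => E'; move: E N3; rewrite E'; lia.
by rewrite modn_small //; lia.
Qed.

Lemma first_sides_closed n : closed (first_sides n).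
Proof.
rewrite (_ : first_sides n = \bigcup_(i in [set i : 'I_N | (i < n)%N]) side p i).
  by apply: closed_bigcup => [|i _]; [exact: finite_finset|exact: segment_closed_pt].
by apply/seteqP; split=> x [i]; exists i.
Qed.

(** Each side after the first starts on the previous ones, and its starting point is counted by
    [kept] without being charged. It therefore adds at most one component less than [kept] has
    members. *)
Lemma covers_first_sides n : (0 < n <= N)%N -> exists2 l, covers (first_sides n) l &
  (size l + n <= 2 + \sum_(i < N | (i < n)%N) #|kept i|)%N.
Proof.
elim: n => // n IH /andP[_ nN]; case: (posnP n) => [n0|n0].
  have cov0 : covers set0 [:: (0, 0)].
    by move=> x _; exists (0, 0); [rewrite inE eqxx|apply: conn_segment => z _ []].
  have [|[]|l sl] := covers_add_dangling closed0 (@next_neq (Ordinal nN)) _ _ cov0.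
    by move=> t _ [].
  rewrite set0U => cl; exists l; last by move: sl; rewrite n0 /=; lia.
  rewrite (_ : first_sides n.+1 = segment (p (Ordinal nN)) (p (nexti (Ordinal nN)))) //.
  apply/seteqP; split=> x; last by move=> h; exists (Ordinal nN).
  case=> i i1; have -> // : i = Ordinal nN by apply: val_inj => /=; lia.
have [|l cl sl] := IH; first by rewrite n0 ltnW.
pose i := Ordinal nN.
(* [j0] is the member of [kept i] that stands for the starting corner [p i], at parameter 0. *)
have [j0 [j0n j0p j0min]] : exists j : 'I_N, [/\ (j < n)%N, side p j (p i) &
  forall k : 'I_N, (k < j)%N -> ~ side p k (p i)].
  apply: first_side; have n1N : (n.-1 < N)%N by lia.
  exists (Ordinal n1N); first by rewrite /=; lia.
  have <- : nexti (Ordinal n1N) = i by apply: val_inj => /=; rewrite prednK // modn_small.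
  exact: segment_right.
pose ab := gam (p i) (p (nexti i)).
(* The parameter on side [i] of its only common point with side [j], with a default value 0 if they
   do not meet. *)
pose tau (j : 'I_N) : R := xget 0 [set t | 0 <= t <= 1 /\ side p j (ab t)].
pose ts := [seq tau j | j <- enum (kept i :\ j0)].
have [|l' sl' cl'] := @covers_add_segment _ (p i) (p (nexti i)) ts l (@first_sides_closed n)
   (@next_neq i) _ cl.
  move=> t /andP[t0 t1] /first_side[j [jn jt jmin]]; apply/mapP; exists j.
    rewrite mem_enum in_setD1; apply/andP; split; last first.
      apply: (@first_kept i j (ab t)) => //.
      by exists t; rewrite (ltW t0) t1.
    apply/eqP => E; rewrite E in jt.
    have : ab t = p i.
      apply: (@side_unique j0 i) => //; last by exact: segment_left.
        by move=> E'; move: j0n; rewrite E' ltnn.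
      by exists t; rewrite (ltW t0) t1.
    rewrite -[RHS](gam0 (p i) (p (nexti i))) => /(gam_inj (@next_neq i)) tz.
    by rewrite tz ltxx in t0.
  have jt' : [set t | 0 <= t <= 1 /\ side p j (ab t)] t by split; rewrite ?(ltW t0).
  rewrite /tau; case: xgetP => [u _ [u01 ju]|/(_ t)//].
  apply: (gam_inj (@next_neq i)); apply: (@side_unique j i) => //.
  - by move=> E; move: jn; rewrite E ltnn.
  - by exists t; rewrite (ltW t0) t1.
  - by exists u.
exists l'.
  rewrite (_ : first_sides n.+1 = first_sides n `|` side p i) //.
  apply/seteqP; split=> x.
    case=> k; rewrite ltnS leq_eqVlt => /orP[/eqP kn|kn] kx; last by left; exists k.
    by right; have <- : k = i by exact: val_inj.
  case=> [[k kn kx]|ix]; last by exists i.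
  by exists k => //; exact: ltnW.
have -> : (\sum_(k < N | (k < n.+1)%N) #|kept k| =
    #|kept i| + \sum_(k < N | (k < n)%N) #|kept k|)%N.
  rewrite (bigD1 i) //=; congr addn; apply: eq_bigl => k.
  by rewrite ltnS (leq_eqVlt k) -(inj_eq val_inj) /=; case: ltngtP.
have := cardsD1 j0 (kept i).
rewrite (@first_kept i j0 (p i)) // => [cK|]; last exact: segment_left.
move: sl' sl cK; rewrite /ts size_map -cardE /=.
by move: #|kept i| #|_ :\ _| (\sum_(k < N | _) _)%N => A B C; lia.
Qed.

Lemma components_kept : exists k, has_card (bounded_components p) k /\
  (k + N <= 1 + \sum_(i < N) #|kept i|)%N.
Proof.
have [|l cl sl] := @covers_first_sides N; first by rewrite leqnn andbT; lia.
have [|k [hk kl]] := @bounded_components_card N p l.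
  rewrite (_ : curve p = first_sides N) //; apply/seteqP; split=> x [i].
    by move=> _ ix; exists i.
  by move=> _ ix; exists i.
exists k; split=> //.
have : (\sum_(i < N) #|kept i| = \sum_(i < N | (i < N)%N) #|kept i|)%N.
  by apply: eq_bigl => i; rewrite ltn_ord.
by move: sl kl; lia.
Qed.

End upper_bound.

End adding_sides.

(** * Full sides and the sense in which the curve turns *)

Section chirality.
Implicit Types (a b c x y z w : pt) (d e m r s t u v : R).

Lemma orient_cycle a b c : orient b c a = orient a b c.
Proof. by rewrite /orient; ring. Qed.

Lemma gam_between a b u v r : u < v -> u <= r <= v ->
  segment (gam a b u) (gam a b v) (gam a b r).
Proof.
move=> uv /andP[ur rv]; have vu : v - u != 0 by rewrite subr_eq0 gt_eqF.
have vu0 : 0 < v - u by lra.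
exists ((r - u) / (v - u)); split.
  by apply/andP; split; [apply: divr_ge0; lra|rewrite ler_pdivrMr //; lra].
by rewrite /gam /=; congr pair; field.
Qed.

(** If one of [c], [e] were on the line of [a] and [b], so would be the other; the segment from [c]
    to [e] would then miss the segment from [a] to [b] or contain both of its ends, against
    uniqueness. *)
Lemma meet_opposite a b c (e : pt) : a <> b ->
  (forall x y, segment a b x -> segment c e x -> segment a b y -> segment c e y -> x = y) ->
  ~ segment a b c -> ~ segment a b e -> segment a b `&` segment c e !=set0 ->
  orient a b c * orient a b e < 0.
Proof.
move=> ab uniq nc ne [z [zab [t [/andP[t0 t1] zt]]]].
have := orient_affine a b c e t; rewrite [gam c e t](esym zt) (segment_orient zab) => E.
have zc : orient a b c != 0 -> orient a b e != 0.
  move=> c0; apply/eqP => e0; rewrite e0 in E.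
  have t11 : t = 1 by apply: (mulIf c0); lra.
  by apply: ne; move: zab; rewrite zt t11 -/(gam c e 1) gam1.
have ze : orient a b e != 0 -> orient a b c != 0.
  move=> e0; apply/eqP => c0; rewrite c0 in E.
  have t00 : t = 0 by apply: (mulIf e0); lra.
  by apply: nc; move: zab; rewrite zt t00 -/(gam c e 0) gam0.
case: (eqVneq (orient a b c) 0) => [c0|c0]; last first.
  have e0 := zc c0.
  have tp : 0 < t.
    by rewrite lt0r t0 andbT; apply: contra_neq c0 => t00; rewrite t00 in E; lra.
  by move: c0; rewrite neq_lt => /orP[] h; move: e0; rewrite neq_lt => /orP[] h'; nra.
have e0 : orient a b e = 0 by apply/eqP/negPn/negP => /ze; rewrite c0 eqxx.
have [u cu] := orient0_gam ab c0; have [v ev] := orient0_gam ab e0.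
have out (w : R) : ~ segment a b (gam a b w) -> w < 0 \/ 1 < w.
  move=> nw; apply: contrapT => h; apply: nw; apply: gam_segment.
  by apply/andP; split; rewrite leNgt; apply/negP => ?; apply: h; [left|right].
have both (p q : R) : p < 0 -> 1 < q -> segment c e = segment (gam a b p) (gam a b q) -> False.
  move=> p0 q1 E'; apply: ab; apply: uniq; try exact: segment_left; try exact: segment_right.
    rewrite E' -[X in segment _ _ X](gam0 a b); apply: gam_between; first by lra.
    by apply/andP; split; lra.
  rewrite E' -[X in segment _ _ X](gam1 a b); apply: gam_between; first by lra.
  by apply/andP; split; lra.
rewrite cu ev in nc ne zt zab *.
have [r [r01 zr]] := zab; rewrite -/(gam a b r) in zr.
have : segment (gam a b u) (gam a b v) z by exists t; rewrite t0 t1.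
rewrite zr => /gam_sub[r' [/(gam_inj ab) <-]]; rewrite ge_min le_max.
case/andP: r01 => r0 r1.
have [u0|u1] := out u nc; have [v0|v1] := out v ne; move=> /orP[] h1 /orP[] h2; try lra.
- by have [] := both u v u0 v1; rewrite cu ev.
- by have [] := both v u v0 u1; rewrite cu ev segmentC.
Qed.

Definition cyc N (N0 : (0 < N)%N) (n : nat) : 'I_N := Ordinal (ltn_pmod n N0).

Lemma cyc_next N (N0 : (0 < N)%N) n : nexti (cyc N0 n) = cyc N0 n.+1.
Proof. by apply: val_inj; rewrite /= -addn1 modnDml addn1. Qed.

Lemma cyc_val N (N0 : (0 < N)%N) (i : 'I_N) : cyc N0 i = i.
Proof. by apply: val_inj; rewrite /= modn_small. Qed.

Lemma cyc_addN N (N0 : (0 < N)%N) n : cyc N0 (n + N) = cyc N0 n.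
Proof. by apply: val_inj; rewrite /= modnDr. Qed.

Section full_sides.
Variables (N : nat) (p : 'I_N -> pt).
Hypotheses (N3 : (3 <= N)%N) (adm : admissible p).

Let N0 : (0 < N)%N. Proof. exact: leq_trans N3. Qed.
Local Notation idx := (cyc N0).
Let P n := p (idx n).

Lemma cyc_neq n k : (0 < k < N)%N -> idx (n + k) <> idx n.
Proof.
move=> /andP[k0 kN] /(congr1 val)/= /eqP; rewrite -[X in _ == X %[mod _]]addn0 eqn_modDl.
by rewrite mod0n modn_small // => /eqP E; rewrite E in k0.
Qed.

Definition apart (i j : 'I_N) : bool := `[< ~ (side p i `&` side p j !=set0) >].

Definition touched (i : 'I_N) : bool :=
  `[< exists j : 'I_N, [/\ j <> i, j <> nexti i & side p i (p j)] >].

Definition full (i : 'I_N) : bool := ~~ [exists j, apart i j] && ~~ touched i.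

(** Side [n + d.+2] meets the full side [n] and has neither end on it, so [meet_opposite]
    applies. *)
Lemma full_alternates (n d : nat) : full (idx n) -> (d.+4 <= N)%N ->
  orient (P n) (P n.+1) (P (n + d.+2)) * orient (P n) (P n.+1) (P (n + d.+3)) < 0.
Proof.
move=> /andP[/existsPn nap /asboolPn nto] dN; rewrite /P -cyc_next.
have ne1 : idx (n + d.+2) <> idx n by apply: cyc_neq; lia.
have ne2 : idx (n + d.+3) <> idx n by apply: cyc_neq; lia.
have ne3 : idx (n + d.+2) <> nexti (idx n).
  by rewrite cyc_next (_ : n + d.+2 = n.+1 + d.+1)%N; [apply: cyc_neq; lia|lia].
have ne4 : idx (n + d.+3) <> nexti (idx n).
  by rewrite cyc_next (_ : n + d.+3 = n.+1 + d.+2)%N; [apply: cyc_neq; lia|lia].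
apply: meet_opposite; first exact: next_neq.
- move=> x y h1 h2 h3 h4; apply: (side_unique adm (not_eq_sym ne1) h1 _ h3).
    by rewrite /side cyc_next -addnS.
  by rewrite /side cyc_next -addnS.
- by move=> h; apply: nto; exists (idx (n + d.+2)).
- by move=> h; apply: nto; exists (idx (n + d.+3)).
- by have := nap (idx (n + d.+2)) => /asboolPn /contrapT; rewrite /side [nexti (idx (n + d.+2))]cyc_next -addnS.
Qed.

(** The sign of [S n k] tells the side of corner [k] with respect to the line of side [n]; that of
    [turn n] tells whether the curve turns left or right at corner [n.+1]. *)
Let S (n k : nat) := orient (P n) (P n.+1) (P k).
Let turn n := S n n.+2.

(* The corners alternate on both sides of the line of a full side. *)
Lemma full_sign (n d : nat) : full (idx n) -> (4 <= N)%N -> (d.+3 <= N)%N ->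
  0 < turn n * ((-1) ^+ d * S n (n + d.+2)).
Proof.
move=> fn N4; elim: d => [|d IH] dN.
  have := @full_alternates n 0 fn N4; rewrite expr0 mul1r /turn -[n.+2]addn2.
  rewrite -/(S n (n + 2)%N); case: (eqVneq (S n (n + 2)%N) 0) => [->|h _].
    by rewrite mul0r ltxx.
  by rewrite -expr2 exprn_even_gt0.
have h1 := full_alternates fn dN; have h2 := IH (ltnW dN).
rewrite -/(S n (n + d.+2)) -/(S n (n + d.+3)) in h1.
have : (turn n * ((-1) ^+ d * S n (n + d.+2))) * (turn n * ((-1) ^+ d.+1 * S n (n + d.+3))) =
   - (turn n * (-1) ^+ d) ^+ 2 * (S n (n + d.+2) * S n (n + d.+3)) by rewrite exprS; ring.
move=> E; rewrite -(pmulr_rgt0 _ h2) E mulNr oppr_gt0 pmulr_rlt0 //.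
rewrite exprn_even_gt0 //=; apply: contraTneq h2 => h2.
by rewrite mulrA h2 mul0r ltxx.
Qed.

Lemma S_addN n k : S n (k + N) = S n k.
Proof. by rewrite /S /P cyc_addN. Qed.

Lemma turn_addN n : turn (n + N) = turn n.
Proof. by rewrite /turn /S /P -!addSn !cyc_addN. Qed.

(* If two segments cross, the one goes from left to right of the other if and
   only if the other goes from right to left of the one. *)
Lemma crossing_sign n k : S n k * S n k.+1 < 0 -> S k n * S k n.+1 < 0 -> S n k * S k n < 0.
Proof.
(* Both differences are the cross product of the directions of the two sides. *)
have : S n k - S n k.+1 = S k n.+1 - S k n by rewrite /S /orient; ring.
move: (S n k) (S n k.+1) (S k n) (S k n.+1) => A B C D E.
case: (ltgtP A 0) => hA; last by rewrite hA !mul0r ltxx.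
  move=> h1; have hB : 0 < B by nra.
  case: (ltgtP C 0) => hC; last by rewrite hC !mul0r ltxx.
    by move=> h2; have hD : 0 < D; [nra|lra].
  by move=> h2; nra.
move=> h1; have hB : B < 0 by nra.
case: (ltgtP C 0) => hC; last by rewrite hC !mul0r ltxx.
  by move=> h2; nra.
by move=> h2; have hD : D < 0; [nra|lra].
Qed.

(** The alternation carries [turn n] to the sign of [S n k] and [turn k] to that of [S k n]. These
    two signs are opposite because the sides cross; adjacent sides are treated apart. *)
Lemma full_opposite (n k : nat) : ~~ odd N -> (4 <= N)%N -> full (idx n) -> full (idx k) ->
  (n < k < n + N)%N -> turn n * turn k < 0.
Proof.
move=> oN N4 fn fk; have adj (m : nat) : full (idx m.+1) -> turn m * turn m.+1 < 0.
  (* Corner [m] is the last one seen from side [m.+1], after [N - 3] changes of sign, an odd number,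
     and its sign there is that of [turn m]. *)
  move=> fm; have := @full_sign m.+1 (N - 3) fm N4; rewrite -addn3 subnK // => /(_ (leqnn N)).
  rewrite -signr_odd oddB // (negbTE oN) /= expr1 (_ : m.+1 + _ = m + N)%N; last by lia.
  rewrite S_addN (_ : S m.+1 m = turn m) /turn; last by rewrite /S orient_cycle.
  by move: (S m m.+2) (S m.+1 m.+3) => A B h; nra.
move=> /andP[nk kn]; have [E|nk1] := eqVneq k n.+1.
  by rewrite E in fk *; exact: adj.
have [E|kn1] := eqVneq k.+1 (n + N)%N.
  by have := adj k; rewrite E turn_addN mulrC; apply; rewrite cyc_addN.
(* Corner [k] comes [d.+2] places after [n], and [n] comes [d'.+2] places after [k]; as [N] is even,
   [d] and [d'] have the same parity. *)
pose d := (k - n - 2)%N; pose d' := (N - 4 - d)%N.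
have kd : (k = n + d.+2)%N by lia.
have nd : (n + N = k + d'.+2)%N by lia.
have h1 := @full_alternates n d fn; have h2 := @full_alternates k d' fk.
have {}h1 : S n k * S n k.+1 < 0 by rewrite kd -addnS; apply: h1; lia.
have {}h2 : S k n * S k n.+1 < 0.
  by rewrite -S_addN -(S_addN k n.+1) addSn nd -addnS; apply: h2; lia.
have h3 := crossing_sign h1 h2.
have := @full_sign n d fn N4; rewrite -kd => h4.
have := @full_sign k d' fk N4; rewrite -nd S_addN => h5.
have {}h4 : 0 < turn n * ((-1) ^+ d * S n k) by apply: h4; lia.
have {}h5 : 0 < turn k * ((-1) ^+ d * S k n).
  have -> : (-1) ^+ d = (-1) ^+ d' :> R.
    rewrite -signr_odd -[RHS]signr_odd; congr (_ ^+ (nat_of_bool _)).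
    have : (d' + d + 4 = N)%N by lia.
    by move=> E; move: oN; rewrite -E !oddD; case: (odd d); case: (odd d').
  by apply: h5; lia.
have : 0 < (turn n * turn k) * (((-1) ^+ d) ^+ 2 * (S n k * S k n)).
  have := mulr_gt0 h4 h5; congr (_ < _); ring.
rewrite -exprM mulnC exprM sqrrN expr1n expr1n mul1r nmulr_lgt0 //.
Qed.

(** Of three nonzero signs two agree, so three full sides cannot have pairwise opposite turns. *)
Lemma card_full : ~~ odd N -> (#|[set i | full i]%SET| <= 2)%N.
Proof.
move=> oN; have N4 : (4 <= N)%N by move: oN N3; case: (N) => [|[|[|[|]]]].
have key (i j : 'I_N) : full i -> full j -> i != j -> turn i * turn j < 0.
  move=> fi fj; rewrite -(inj_eq val_inj) neq_ltn => /orP[] /= h.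
    apply: full_opposite; rewrite ?cyc_val // h /=.
    by apply: leq_trans (ltn_ord j) _; exact: leq_addl.
  rewrite mulrC; apply: full_opposite; rewrite ?cyc_val // h /=.
  by apply: leq_trans (ltn_ord i) _; exact: leq_addl.
rewrite leqNgt; apply/negP => /card_gt2P[i [j [k [[]]]]].
rewrite !inE => fi fj fk [ij jk ki].
have := key _ _ fi fj ij; have := key _ _ fj fk jk; have := key _ _ fk fi ki.
move: (turn i) (turn j) (turn k) => A B C h1 h2 h3.
have : 0 < - (A * B * C) ^+ 2.
  have -> : - (A * B * C) ^+ 2 = - ((C * A) * ((B * C) * (A * B))) by ring.
  by rewrite oppr_gt0 nmulr_rlt0 // nmulr_rgt0.
by rewrite oppr_gt0 ltNge sqr_ge0.
Qed.

End full_sides.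

End chirality.

(** * Counting the pairs of sides that bring no new point *)

Section counting_lost_pairs.
Lemma card_pairs N (P : rel 'I_N) :
  #|[set ji : 'I_N * 'I_N | P ji.1 ji.2]%SET| = (\sum_i \sum_(j | P j i) 1)%N.
Proof.
rewrite -sum1_card (exchange_big_dep xpredT) //= pair_big_dep /=; apply: eq_bigl => -[j i].
by rewrite !inE.
Qed.

Section lost_pairs.
Variables (N : nat) (p : 'I_N -> pt).
Hypotheses (N3 : (3 <= N)%N) (adm : admissible p).

Definition lost_pairs : {set 'I_N * 'I_N} :=
  [set ji : 'I_N * 'I_N | (ji.1 < ji.2)%N && lost p ji.1 ji.2]%SET.

Definition apart_pairs : {set 'I_N * 'I_N} :=
  [set ji : 'I_N * 'I_N | (ji.1 < ji.2)%N && apart p ji.1 ji.2]%SET.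

Definition sort_pair (i j : 'I_N) : 'I_N * 'I_N := if (i < j)%N then (i, j) else (j, i).

Lemma sort_pair_lt i j : i != j -> ((sort_pair i j).1 < (sort_pair i j).2)%N.
Proof. by rewrite /sort_pair -(inj_eq val_inj) /= neq_ltn; case: ltngtP. Qed.

Lemma sort_pair_eq i j k l : sort_pair i j = sort_pair k l ->
  i = k /\ j = l \/ i = l /\ j = k.
Proof.
by rewrite /sort_pair; case: ifP => _; case: ifP => _ [-> ->]; [left|right|right|left].
Qed.

Lemma apartC i j : apart p i j = apart p j i.
Proof. by rewrite /apart setIC. Qed.

(** A side that misses another one is a member of an apart pair, and a pair has two members. *)
Lemma card_not_meeting_all :
  (#|[set i | [exists j, apart p i j]]%SET| <= #|apart_pairs| + #|apart_pairs|)%N.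
Proof.
set B := [set i | _]%SET.
have sub : B \subset ([set ji.1 | ji in apart_pairs] :|: [set ji.2 | ji in apart_pairs])%SET.
  apply/fintype.subsetP => i; rewrite inE => /existsP[j ij].
  have nij : i != j.
    apply: contraTneq ij => <-; apply/asboolPn; apply; exists (p i).
    by split; exact: segment_left.
  rewrite inE; have := sort_pair_lt nij; rewrite /sort_pair; case: ifP => h /= h'.
    by apply/orP; left; apply/imsetP; exists (i, j) => //; rewrite inE /= h.
  by apply/orP; right; apply/imsetP; exists (j, i) => //; rewrite inE /= h' apartC.
apply: leq_trans (subset_leq_card sub) _; apply: leq_trans (leq_card_setU _ _) _.
by apply: leq_add; exact: leq_imset_card.
Qed.


(** Of three sides through one point, the two of larger index bring no new point to each other,
    although they meet. *)
Lemma lost_pair_meeting i j k x : side p i x -> side p j x -> side p k x ->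
  i != j -> (k < i)%N -> (k < j)%N -> sort_pair i j \in lost_pairs :\: apart_pairs.
Proof.
move=> ix jx kx ij ki kj; rewrite finset.in_setD /apart_pairs /lost_pairs !inE (sort_pair_lt ij) /=.
have [h1 h2 h3] : [/\ side p (sort_pair i j).1 x, side p (sort_pair i j).2 x
    & (k < (sort_pair i j).1)%N] by rewrite /sort_pair; case: ifP.
apply/andP; split; first by apply/asboolPn; apply; exists x.
by apply/asboolP; right; exists k => //; exists x.
Qed.

(* A side through a corner [p j] not its own is charged to one of the lost
   pairs at that corner: [(j-1, j)] for the first side through [p j], and the
   pair formed with [max (j-1) j] for the others. *)
Lemma card_touched :
  (#|[set i | touched p i]%SET| <= #|lost_pairs :\: apart_pairs|)%N.
Proof.
set B := [set i | _]%SET.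
have /choice[f hf] : forall i, exists j : 'I_N, touched p i ->
    [/\ j <> i, j <> nexti i & side p i (p j)].
  move=> i; case: (boolP (touched p i)) => [/asboolP[j h]|_]; by [exists j|exists i].
have /choice[pr hpr] : forall j : 'I_N, exists h : 'I_N, nexti h = j.
  by move=> j; exists (ord_pred j); exact: ord_predK.
(* Side [pr j] ends at corner [j]; it is the earlier of the two sides there except at corner 0,
   where it is the last side of all. *)
pose hi j := if (pr j < j)%N then j else pr j.
pose lo j := if (pr j < j)%N then pr j else j.
have nprev j : pr j != j.
  apply/eqP => E; apply: (next_neq N3 adm (i := j)); by rewrite -{2}E hpr.
have prx j : side p (pr j) (p j) by rewrite -{2}(hpr j); exact: segment_right.
have jx j : side p j (p j) by exact: segment_left.
have lohi j : [/\ (lo j < hi j)%N, side p (lo j) (p j) & side p (hi j) (p j)].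
  rewrite /lo /hi; have := nprev j; rewrite -(inj_eq val_inj) /= neq_ltn.
  by case: ifP => //= _ h; split.
have nlo i : touched p i -> i != lo (f i) /\ i != hi (f i).
  move=> /hf[h1 h2 h3]; rewrite /lo /hi; case: ifP => _; split; apply/eqP => E.
  - by apply: h2; rewrite [in RHS]E hpr.
  - by apply: h1; rewrite -E.
  - by apply: h1; rewrite -E.
  - by apply: h2; rewrite [in RHS]E hpr.
(* [later i] fails when [i] is the first side through its chosen corner; only then is the pair of
   the two sides ending at that corner charged. *)
pose later (i : 'I_N) := [exists k : 'I_N, (k < i)%N && `[< side p k (p (f i)) >]].
pose g i := if later i then sort_pair i (hi (f i)) else sort_pair (lo (f i)) (hi (f i)).
have gB i : touched p i -> g i \in lost_pairs :\: apart_pairs /\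
   side p (g i).1 (p (f i)) /\ side p (g i).2 (p (f i)).
  move=> ti; have [h1 h2 h3] := hf i ti; have [n1 n2] := nlo i ti.
  have [l1 l2 l3] := lohi (f i); rewrite /g; case: ifP => [/existsP[k /andP[ki /asboolP kx]]|nl].
    split; last by rewrite /sort_pair; case: ifP.
    case: (ltnP i (hi (f i))) => ih.
      by apply: (lost_pair_meeting h3 l3 kx) => //; exact: ltn_trans ih.
    have hi_i : (hi (f i) < i)%N by rewrite ltn_neqAle ih andbT eq_sym.
    by apply: (lost_pair_meeting h3 l3 l2) => //; exact: ltn_trans hi_i.
  split; last by rewrite /sort_pair; case: ifP.
  have ilo : (i < lo (f i))%N.
    rewrite ltn_neqAle n1 leqNgt; apply/negP => h; move/negbT/negP: nl; apply.
    by rewrite /later; apply/existsP; exists (lo (f i)); rewrite h; apply/asboolP.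
  apply: (lost_pair_meeting l2 l3 h3) => //; last exact: ltn_trans l1.
  by rewrite -(inj_eq val_inj) /= neq_ltn l1.
have ginj : {in B &, injective g}.
  move=> i i'; rewrite !finset.in_set => ti ti' E.
  have [gi [g1 g2]] := gB i ti; have [_ [g1' g2']] := gB i' ti'; rewrite -E in g1' g2'.
  (* The two sides of the charged pair have only this corner in common, so the pair determines the
     corner. *)
  have ff : f i = f i'.
    have [pinj _] := adm; apply: pinj.
    apply: (side_unique adm (i := (g i).1) (j := (g i).2)) => //.
    by move: gi; rewrite !inE => /andP[_ /andP[h _]] E'; rewrite E' ltnn in h.
  have [n1 n2] := nlo i ti; have [n1' n2'] := nlo i' ti'.
  have [_ _ h3] := hf i ti; have [_ _ h3'] := hf i' ti'.
  move: E; rewrite /g -ff; rewrite -ff in n1' n2' h3'.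
  case: ifP => li; case: ifP => li'.
  - by move/sort_pair_eq => [[]//|[E1 _]]; rewrite -E1 eqxx in n2.
  - by move/sort_pair_eq => [[E1 _]|[E1 _]]; [rewrite -E1 eqxx in n1|rewrite -E1 eqxx in n2].
  - by move/sort_pair_eq => [[E1 _]|[_ E1]]; [rewrite E1 eqxx in n1'|rewrite E1 eqxx in n2'].
  - move=> _; apply: val_inj => /=; case: (ltngtP i i') => // h.
      by move/negbT/negP: li'; case; rewrite /later; apply/existsP; exists i; rewrite h -ff; apply/asboolP.
    by move/negbT/negP: li; case; rewrite /later; apply/existsP; exists i'; rewrite h; apply/asboolP.
rewrite -(card_in_imset ginj); apply/subset_leq_card/fintype.subsetP => _ /imsetP[i iB ->].
by rewrite finset.in_set in iB; have [] := gB i iB.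
Qed.

(** Every side is full, misses another side, or is touched. So [N] is at most 2, plus twice the
    number of apart pairs, plus the number of other lost pairs. *)
Lemma card_lost_pairs : ~~ odd N -> (N <= 2 * #|lost_pairs| + 2)%N.
Proof.
move=> oN; have h1 := card_not_meeting_all; have h2 := card_touched.
have h3 := card_full N3 adm oN.
have sub : apart_pairs \subset lost_pairs.
  apply/fintype.subsetP => ji; rewrite !inE => /andP[-> /asboolP h] /=.
  by apply/asboolP; left.
have h4 := cardsID apart_pairs lost_pairs; rewrite (finset.setIidPr sub) in h4.
have : (N <= #|[set i | full p i]%SET| + #|[set i | [exists j, apart p i j]]%SET| +
    #|[set i | touched p i]%SET|)%N.
  rewrite -[X in (X <= _)%N]card_ord -cardsT.
  apply: leq_trans (leq_add (leq_card_setU _ _) (leqnn _)); apply: leq_trans (leq_card_setU _ _).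
  apply/subset_leq_card/fintype.subsetP => i _; rewrite !inE /full.
  by case: [exists j, _]; case: touched.
by move: h1 h2 h3 h4; move: #|apart_pairs| #|lost_pairs|; lia.
Qed.

Lemma sum_kept : (\sum_(i < N) #|kept p i| + #|lost_pairs| = 'C(N, 2))%N.
Proof.
rewrite (_ : (\sum_(i < N) #|kept p i| =
   #|[set ji : 'I_N * 'I_N | (ji.1 < ji.2)%N && ~~ lost p ji.1 ji.2]%SET|)%N); last first.
  rewrite (@card_pairs N (fun j i : 'I_N => (j < i)%N && ~~ lost p j i)).
  by apply: eq_bigr => i _; rewrite -sum1_card; apply: eq_bigl => j; rewrite inE.
rewrite -[RHS]bin2_sum big_mkord.
have -> : (\sum_(i < N) i = #|[set ji : 'I_N * 'I_N | (ji.1 < ji.2)%N]%SET|)%N.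
  rewrite (@card_pairs N (fun j i : 'I_N => (j < i)%N)); apply: eq_bigr => i _.
  by rewrite -(big_ord_widen N (fun=> 1%N) (ltnW (ltn_ord i))) sum1_card card_ord.
rewrite -(cardsID lost_pairs [set ji : 'I_N * 'I_N | (ji.1 < ji.2)%N]%SET) addnC.
congr (_ + _)%N; apply: eq_card => -[j i].
  by rewrite finset.in_setI !finset.in_set /= andbA andbb.
by rewrite finset.in_setD !finset.in_set /=; case: ltnP => _; rewrite ?andbF ?andbT.
Qed.

End lost_pairs.

Lemma fmax_odd k : (0 < k)%N -> fmax k.*2.+1 = (2 * (k * k) - k)%N.
Proof.
move=> k0; rewrite /fmax /= odd_double /=.
rewrite (_ : k.*2.+1 * k.*2.+1 - 3 * k.*2.+1 = (2 * (k * k) - k - 1) * 2)%N.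
  by rewrite mulnK //; nia.
by nia.
Qed.

Lemma fmax_even k : fmax k.*2 = (2 * (k * k) + 2 - 4 * k)%N.
Proof.
rewrite /fmax /= odd_double /= (_ : k.*2 * k.*2 = (2 * (k * k)) * 2)%N; last by nia.
by rewrite mulnK //; nia.
Qed.

(** At most [1 + 'C(N, 2) - N] bounded components arise, less the number of lost pairs, which is at
    least [N/2 - 1] for even [N]. *)
Lemma components_le_fmax N (p : 'I_N -> pt) : (3 <= N)%N -> admissible p ->
  exists k, has_card (bounded_components p) k /\ (k <= fmax N)%N.
Proof.
move=> N3 adm; have [k [hk kN]] := components_kept N3 adm; exists k; split=> //.
have sk := sum_kept p; have lp := @card_lost_pairs N p N3 adm.
have b2 : ('C(N, 2) * 2 = N * N.-1)%N.
  by rewrite bin2 muln2 halfK oddM; case: (N) N3 => // n _ /=; rewrite andNb subn0.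
move: sk kN lp b2; move: (\sum_(i < N) _)%N #|lost_pairs p| 'C(N, 2) => A L C.
move: N3; clear; case: (boolP (odd N)) => oN N3.
  have [m Nm] : exists m, N = m.*2.+1 by exists N./2; rewrite -{1}[N]odd_double_half oN.
  by rewrite Nm in N3 *; rewrite fmax_odd; [nia|lia].
have [m Nm] : exists m, N = m.*2.
  by exists N./2; rewrite -{1}[N]odd_double_half (negbTE oN).
rewrite Nm in N3 *; rewrite fmax_even => h1 h2 /(_ isT) h4 h3.
by nia.
Qed.

End counting_lost_pairs.

(** * Crossing parities of loops *)

Section crossing_parity.
Implicit Types (a b c q x y z w : pt) (d e m r s t u : R).

(* Parity of the number of edges of a closed polygon lying below a point; the
   half-open test on abscissae makes corners harmless. *)
Definition above a b x : bool :=
  ((a.1 <= x.1) (+) (b.1 <= x.1)) && (0 < orient a b x * (b.1 - a.1)).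

(* What an end of an edge adds to the variation of [above] near [x0]; each corner
   of a closed polygon ends two edges, so these terms cancel. *)
Definition step (x0 v x : pt) : bool := ((v.1 <= x.1) (+) (v.1 <= x0.1)) && (v.2 < x0.2).

Lemma abscissa_local (h : R) x0 : h != x0.1 ->
  exists2 e : R, 0 < e & forall x, box e x0 x -> (h <= x.1) = (h <= x0.1).
Proof.
rewrite neq_lt => /orP[] hx.
  exists (x0.1 - h); first by rewrite subr_gt0.
  by move=> x [? ? _ _]; rewrite (ltW hx); apply/idP; lra.
exists (h - x0.1); first by rewrite subr_gt0.
by move=> x [? ? _ _]; rewrite [RHS]leNgt hx; apply/negbTE; rewrite -ltNge; lra.
Qed.

Lemma orient_local a b x0 : orient a b x0 != 0 ->
  exists2 e : R, 0 < e & forall x, box e x0 x -> 0 < orient a b x * orient a b x0.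
Proof.
move=> z0; pose D := 1 + `|b.1 - a.1| + `|b.2 - a.2|.
have n1 := normr_ge0 (b.1 - a.1); have n2 := normr_ge0 (b.2 - a.2).
have D0 : 0 < D by rewrite /D; lra.
have o1 : 0 < `|orient a b x0| by rewrite normr_gt0.
pose e := `|orient a b x0| / D; have e0 : 0 < e by exact: divr_gt0.
exists e => // x [h1 h2 h3 h4].
have E : orient a b x - orient a b x0 = (b.1 - a.1) * (x.2 - x0.2) - (b.2 - a.2) * (x.1 - x0.1).
  by rewrite /orient; ring.
have small : `|orient a b x - orient a b x0| < `|orient a b x0|.
  have -> : `|orient a b x0| = D * e by rewrite /e mulrC divfK // gt_eqF.
  have k1 : `|x.2 - x0.2| < e by rewrite ltr_norml; apply/andP; split; lra.
  have k2 : `|x.1 - x0.1| < e by rewrite ltr_norml; apply/andP; split; lra.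
  rewrite E; apply: le_lt_trans (ler_normB _ _) _; rewrite !normrM /D.
  by nra.
move: small; case: (ltgtP (orient a b x0) 0) z0 => // h _.
  by rewrite (ltr0_norm h) ltr_norml => /andP[? ?]; nra.
by rewrite (gtr0_norm h) ltr_norml => /andP[? ?]; nra.
Qed.

Lemma vertical_segment (a1 a2 b2 y2 : R) : a2 <= y2 <= b2 -> segment (a1, a2) (a1, b2) (a1, y2).
Proof.
move=> /andP[h1 h2]; case: (eqVneq a2 b2) => [ab|nab].
  have -> : y2 = a2 by lra.
  exact: segment_left.
have d0 : b2 - a2 != 0 by rewrite subr_eq0 eq_sym.
have d1 : 0 < b2 - a2 by rewrite subr_gt0 lt_neqAle nab /=; lra.
exists ((y2 - a2) / (b2 - a2)); split.
  by apply/andP; split; [apply: divr_ge0; lra|rewrite ler_pdivrMr //; lra].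
by rewrite /= subrr mulr0 addr0 divfK //; congr pair; lra.
Qed.

Lemma vertical_side a b x : a.1 = b.1 -> a.1 = x.1 -> ~ segment a b x ->
  (a.2 < x.2) = (b.2 < x.2).
Proof.
case: a b x => [a1 a2] [b1 b2] [x1 x2] /= -> <- nx.
case: (ltP a2 x2) => h1; case: (ltP b2 x2) => h2 //.
  by case: nx; apply: vertical_segment; rewrite (ltW h1).
by case: nx; rewrite segmentC; apply: vertical_segment; rewrite (ltW h2).
Qed.

(** Near [x0] only the test on the abscissa of an end straight above or below [x0] can change. On a
    non-vertical edge such an end is below [x0] exactly when the line of the edge is, which [step]
    records; for a vertical edge the terms of the two ends cancel. *)
Lemma above_local a b x0 : ~ segment a b x0 -> exists2 e : R, 0 < e &
  forall x, box e x0 x -> above a b x (+) above a b x0 = step x0 a x (+) step x0 b x.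
Proof.
move=> nx0.
have stepF (v : pt) : exists2 e : R, 0 < e & forall x, box e x0 x -> v.1 != x0.1 ->
    (v.1 <= x.1) = (v.1 <= x0.1).
  case: (eqVneq v.1 x0.1) => [E|/abscissa_local[e e0 h]]; last by exists e => // x /h.
  by exists 1.
have [ea ea0 ha] := stepF a; have [eb eb0 hb] := stepF b.
case: (eqVneq a.1 b.1) => [ab|ab].
  exists ea => // x xb; rewrite /above ab !addbb /= /step.
  case: (eqVneq a.1 x0.1) => [ax|ax]; last by rewrite -ab ha // addbb.
  by rewrite -ab (vertical_side ab ax nx0) addbb.
(* If [x0] is on the line but off the segment, its abscissa is strictly outside the range of the
   edge, so that both tests agree and stay constant. *)
case: (eqVneq (orient a b x0) 0) => [z0|z0].
  have anb : a <> b by move=> E; rewrite E eqxx in ab.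
  have [t xt] := orient0_gam anb z0.
  have d0 : b.1 - a.1 != 0 by rewrite subr_eq0 eq_sym.
  have t01 : t < 0 \/ 1 < t.
    apply: contrapT => h; apply: nx0; rewrite xt; apply: gam_segment.
    by apply/andP; split; rewrite leNgt; apply/negP => ?; apply: h; [left|right].
  have x01 : x0.1 = a.1 + t * (b.1 - a.1) by rewrite xt.
  have ax : a.1 != x0.1.
    rewrite x01 -subr_eq0 opprD addrA subrr add0r oppr_eq0 mulf_eq0 (negbTE d0) orbF.
    by apply/eqP; case: t01 => h; lra.
  have bx : b.1 != x0.1.
    rewrite x01 -subr_eq0; have -> : b.1 - (a.1 + t * (b.1 - a.1)) = (1 - t) * (b.1 - a.1) by ring.
    by rewrite mulf_eq0 (negbTE d0) orbF; apply/eqP; case: t01 => h; lra.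
  exists (Num.min ea eb); first by rewrite lt_min ea0.
  move=> x xb.
  have xa : box ea x0 x by apply: box_sub xb; rewrite ge_min lexx.
  have {}xb : box eb x0 x by apply: box_sub xb; rewrite ge_min lexx orbT.
  rewrite /step (ha x xa ax) (hb x xb bx) !addbb /= /above (ha x xa ax) (hb x xb bx).
  suff -> : (a.1 <= x0.1) = (b.1 <= x0.1) by rewrite addbb.
  by rewrite x01; move: d0; rewrite neq_lt => /orP[] d0; case: t01 => ht; apply/idP/idP => ?; nra.
have [eo eo0 ho] := orient_local z0.
exists (Num.min eo (Num.min ea eb)); first by rewrite !lt_min eo0 ea0.
move=> x xb.
have xo : box eo x0 x by apply: box_sub xb; rewrite !ge_min lexx.
have xa : box ea x0 x by apply: box_sub xb; rewrite !ge_min lexx ?orbT.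
have {}xb : box eb x0 x by apply: box_sub xb; rewrite !ge_min lexx ?orbT.
have sgn : (0 < orient a b x * (b.1 - a.1)) = (0 < orient a b x0 * (b.1 - a.1)).
  have := ho x xo; move: (orient a b x) (orient a b x0) (b.1 - a.1) => A B C h.
  by apply/idP/idP => h'; nra.
pose sg := 0 < orient a b x0 * (b.1 - a.1).
have D0 : 0 < (b.1 - a.1) ^+ 2 by rewrite exprn_even_gt0 //= subr_eq0 eq_sym.
have corner (v : pt) : v.1 = x0.1 -> orient a b x0 = (b.1 - a.1) * (x0.2 - v.2) ->
    (v.2 < x0.2) = sg.
  move=> _ E; rewrite /sg E (_ : _ * _ * _ = (b.1 - a.1) ^+ 2 * (x0.2 - v.2)); last by ring.
  by rewrite pmulr_rgt0 // subr_gt0.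
have stepa : step x0 a x = ((a.1 <= x.1) (+) (a.1 <= x0.1)) && sg.
  rewrite /step; case: (eqVneq a.1 x0.1) => [ax|ax]; last by rewrite ha // addbb.
  by rewrite (corner a ax) // /orient -ax; ring.
have stepb : step x0 b x = ((b.1 <= x.1) (+) (b.1 <= x0.1)) && sg.
  rewrite /step; case: (eqVneq b.1 x0.1) => [bx|bx]; last by rewrite hb // addbb.
  by rewrite (corner b bx) // /orient -bx; ring.
rewrite stepa stepb /above sgn -/sg.
by case: (sg); rewrite ?andbF ?andbT // addbACA.
Qed.

Lemma above_vertical a b x0 : ~ segment a b x0 -> exists2 e : R, 0 < e &
  forall x, box e x0 x -> x.1 = x0.1 -> above a b x = above a b x0.
Proof.
move=> /above_local[e e0 h]; exists e => // x /h + xv; rewrite /step xv !addbb /=.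
by case: (above a b x); case: (above a b x0).
Qed.

Lemma above_jump a b t (h : R) : a.1 != b.1 -> 0 < t < 1 -> 0 < h ->
  let z := gam a b t in above a b (z.1, z.2 + h) (+) above a b (z.1, z.2 - h).
Proof.
move=> ab /andP[t0 t1] h0 /=.
have d0 : b.1 - a.1 != 0 by rewrite subr_eq0 eq_sym.
have D0 : 0 < (b.1 - a.1) ^+ 2 by rewrite exprn_even_gt0.
have E k : orient a b (a.1 + t * (b.1 - a.1), a.2 + t * (b.2 - a.2) + k) * (b.1 - a.1) =
    (b.1 - a.1) ^+ 2 * k by rewrite /orient /=; ring.
rewrite /above !E /= mulrN oppr_gt0 (ltNge _ 0) (ltW (mulr_gt0 D0 h0)) andbF addbF.
rewrite (mulr_gt0 D0 h0) andbT.
move: d0; rewrite neq_lt => /orP[] d0.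
  have /negbTE -> : ~~ (a.1 <= a.1 + t * (b.1 - a.1)) by rewrite -ltNge; nra.
  by have -> : b.1 <= a.1 + t * (b.1 - a.1) by nra.
have /negbTE -> : ~~ (b.1 <= a.1 + t * (b.1 - a.1)) by rewrite -ltNge; nra.
by have -> : a.1 <= a.1 + t * (b.1 - a.1) by nra.
Qed.

(** Outside a square around the edge, a point whose abscissa is in the range of the edge is above it
    exactly when it is above the square. The value is thus a sum of one term for each end, and such
    terms cancel around a loop. *)
Lemma above_far (M : R) a b x : - M < a.1 < M -> - M < b.1 < M -> - M < a.2 < M ->
  - M < b.2 < M -> ~~ [&& - M < x.1, x.1 < M, - M < x.2 & x.2 < M] ->
  above a b x = ((a.1 <= x.1) && (M <= x.2)) (+) ((b.1 <= x.1) && (M <= x.2)).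
Proof.
move=> /andP[a1 a2] /andP[b1 b2] /andP[a3 a4] /andP[b3 b4] far.
rewrite -andb_addl /above.
have alt : - M < x.1 -> x.1 < M -> x.2 <= - M \/ M <= x.2.
  move=> x1 x2; case: (leP x.2 (- M)) => [|h1]; first by left.
  case: (leP M x.2) => [|h2]; first by right.
  by move/negP: far; case; apply/and4P; split.
case: (ltP a.1 b.1) => ab.
  case: (leP b.1 x.1) => bx; first by rewrite (le_trans (ltW ab) bx).
  case: (leP a.1 x.1) => ax //=.
  have [h|h] := alt (lt_le_trans a1 ax) (lt_trans bx b2).
    have /negbTE -> : ~~ (0 < orient a b x * (b.1 - a.1)).
      by rewrite -leNgt pmulr_lle0 ?subr_gt0 // /orient; nra.
    by apply/esym/negbTE; rewrite -ltNge; lra.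
  by rewrite h pmulr_lgt0 ?subr_gt0 // /orient; nra.
case: (leP a.1 x.1) => ax; first by rewrite (le_trans ab ax).
case: (leP b.1 x.1) => bx //=.
have {}ab : b.1 < a.1 by lra.
have [h|h] := alt (lt_le_trans b1 bx) (lt_trans ax a2).
  have /negbTE -> : ~~ (0 < orient a b x * (b.1 - a.1)).
    by rewrite -leNgt nmulr_lle0 ?subr_lt0 // /orient; nra.
  by apply/esym/negbTE; rewrite -ltNge; lra.
by rewrite h nmulr_lgt0 ?subr_lt0 // /orient; nra.
Qed.

End crossing_parity.

(** * Parities of the loops cut out of a path *)

Section loop_parities.
Implicit Types (a b c q x y z w : pt) (d e r s t u : R).

Lemma segment_sub a b c q : segment a b c -> segment a b q -> segment c q `<=` segment a b.
Proof.
move=> [t [/andP[t0 t1] ->]] [u [/andP[u0 u1] ->]] x.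
rewrite -/(gam a b t) -/(gam a b u) => /gam_sub[s [-> h1 h2]]; apply: gam_segment.
by move: h1 h2; rewrite ge_min le_max => /orP[] ? /orP[] ?; apply/andP; split; lra.
Qed.

(** One radius serves finitely many local conditions that persist when the radius shrinks. *)
Lemma finite_pos (I : finType) (A : {pred I}) (Q : I -> R -> Prop) :
  (forall i e e', Q i e -> 0 < e' -> e' <= e -> Q i e') ->
  (forall i, i \in A -> exists2 e : R, 0 < e & Q i e) ->
  exists2 e : R, 0 < e & forall i, i \in A -> Q i e.
Proof.
move=> mono H.
suff [e e0 h] : exists2 e : R, 0 < e & forall i, i \in enum A -> Q i e.
  by exists e => // i iA; apply: h; rewrite mem_enum.
have : {subset enum A <= A} by move=> i; rewrite mem_enum.
elim: (enum A) => [|i s IH] sub; first by exists 1.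
have [|e e0 h] := IH; first by move=> j js; apply: sub; rewrite inE js orbT.
have [|e' e'0 h'] := H i; first by apply: sub; rewrite inE eqxx.
exists (Num.min e e'); first by rewrite lt_min e0.
move=> j; rewrite inE => /orP[/eqP ->|js].
  by apply: (mono _ e') => //; rewrite ?lt_min ?e0 // ge_min lexx orbT.
by apply: (mono _ e); rewrite ?lt_min ?e0 // ?ge_min ?lexx //; exact: h.
Qed.

Section loops.
Variable P : nat -> pt.

Definition path_parity (m n : nat) x := \big[addb/false]_(m <= k < n) above (P k) (P k.+1) x.

(* Crossing parity of the loop [q, P (j+1), ..., P i, q], where [q] is meant to be
   a common point of sides [j] and [i]. *)
Definition loop_parity (q : pt) (j i : nat) x :=
  above q (P j.+1) x (+) path_parity j.+1 i x (+) above (P i) q x.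

Lemma addb_telescope (g : nat -> bool) m n : (m <= n)%N ->
  \big[addb/false]_(m <= k < n) (g k (+) g k.+1) = g m (+) g n.
Proof.
move=> mn; rewrite -(subnKC mn); elim: (n - m)%N => [|d IH].
  by rewrite addn0 big_geq // addbb.
rewrite addnS big_nat_recr ?leq_addr //= IH.
by case: (g m); case: (g (m + d)%N); case: (g (m + d).+1).
Qed.

Lemma path_local m n x0 : (m <= n)%N ->
  (forall k, (m <= k < n)%N -> ~ segment (P k) (P k.+1) x0) ->
  exists2 e : R, 0 < e & forall x, box e x0 x ->
  forall k, (m <= k < n)%N -> above (P k) (P k.+1) x (+) above (P k) (P k.+1) x0 =
     step x0 (P k) x (+) step x0 (P k.+1) x.
Proof.
move=> mn H.
have [|k kA|e e0 h] := @finite_pos 'I_n [pred k : 'I_n | (m <= k)%N] (fun k e => forall x, box e x0 x ->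
   above (P k) (P k.+1) x (+) above (P k) (P k.+1) x0 = step x0 (P k) x (+) step x0 (P k.+1) x).
- by move=> i e e' h _ ee x xb; apply: h; exact: box_sub xb.
- by apply: above_local; apply: H; rewrite ltn_ord andbT; exact: kA.
exists e => // x xb k /andP[mk kn]; exact: (h (Ordinal kn) mk x xb).
Qed.

Lemma path_parity_local m n x0 : (m <= n)%N ->
  (forall k, (m <= k < n)%N -> ~ segment (P k) (P k.+1) x0) ->
  exists2 e : R, 0 < e & forall x, box e x0 x ->
  path_parity m n x (+) path_parity m n x0 = step x0 (P m) x (+) step x0 (P n) x.
Proof.
move=> mn H; have [e e0 h] := path_local mn H; exists e => // x xb.
rewrite /path_parity -big_split /= -(addb_telescope (fun k => step x0 (P k) x)) //.
by apply: eq_big_nat => k kmn; exact: h.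
Qed.

(** Each corner of the loop, [q] included, ends two of its edges, so the [step] terms cancel in
    pairs. *)
Lemma loop_local q j i x0 : (j < i)%N -> ~ segment q (P j.+1) x0 ->
  (forall k, (j < k < i)%N -> ~ segment (P k) (P k.+1) x0) -> ~ segment (P i) q x0 ->
  exists2 e : R, 0 < e & forall x, box e x0 x -> loop_parity q j i x = loop_parity q j i x0.
Proof.
move=> ji h1 h2 h3; have [e1 e10 k1] := above_local h1; have [e3 e30 k3] := above_local h3.
have [e2 e20 k2] := path_parity_local ji h2.
exists (Num.min e1 (Num.min e2 e3)); first by rewrite !lt_min e10 e20.
move=> x xb.
have := k1 x (box_sub _ xb); have := k2 x (box_sub _ xb); have := k3 x (box_sub _ xb).
rewrite !ge_min !lexx !orbT => /(_ isT) E3 /(_ isT) E2 /(_ isT) E1.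
rewrite /loop_parity; move: E1 E2 E3.
case: (above q _ x); case: (above q _ x0); case: (path_parity _ _ x);
case: (path_parity _ _ x0); case: (above _ q x); case: (above _ q x0);
by case: (step x0 q x); case: (step x0 (P j.+1) x); case: (step x0 (P i) x).
Qed.

Lemma loop_far (M : R) q j i x : (j < i)%N -> - M < q.1 < M -> - M < q.2 < M ->
  (forall k, - M < (P k).1 < M /\ - M < (P k).2 < M) ->
  ~~ [&& - M < x.1, x.1 < M, - M < x.2 & x.2 < M] -> loop_parity q j i x = false.
Proof.
move=> ji q1 q2 PM far; pose g (v : pt) := (v.1 <= x.1) && (M <= x.2).
have E k l : above (P k) (P l) x = g (P k) (+) g (P l).
  by have [? ?] := PM k; have [? ?] := PM l; apply: above_far.
rewrite /loop_parity /path_parity (eq_bigr (fun k => g (P k) (+) g (P k.+1))); last by [].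
rewrite (addb_telescope (fun k => g (P k))) //.
have [? ?] := PM j.+1; have [? ?] := PM i.
rewrite !(@above_far M) // -!/(g _).
by case: (g q); case: (g (P j.+1)); case: (g (P i)).
Qed.

(** Only the last edge, from [P i] to [q], is crossed; the other edges miss [z], and their [step]
    terms vanish on the vertical line through it. *)
Lemma loop_jump q j i t : (j < i)%N -> (P i).1 != q.1 -> 0 < t < 1 ->
  let z := gam (P i) q t in ~ segment q (P j.+1) z ->
  (forall k, (j < k < i)%N -> ~ segment (P k) (P k.+1) z) ->
  exists2 e : R, 0 < e & forall h, 0 < h -> h < e ->
    loop_parity q j i (z.1, z.2 + h) (+) loop_parity q j i (z.1, z.2 - h).
Proof.
move=> ji iq t01 z h1 h2; have [e1 e10 k1] := above_vertical h1.
have [e2 e20 k2] := path_parity_local ji h2.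
exists (Num.min e1 e2); first by rewrite lt_min e10.
move=> h h0; rewrite lt_min => /andP[he1 he2].
have up e : h < e -> box e z (z.1, z.2 + h) by move=> he; split => /=; lra.
have dn e : h < e -> box e z (z.1, z.2 - h) by move=> he; split => /=; lra.
have := above_jump iq t01 h0; rewrite -/z /= => J.
have := k2 _ (up _ he2); have := k2 _ (dn _ he2).
rewrite /step /= !addbb /= => E1 E2.
rewrite /loop_parity (k1 _ (up _ he1)) // (k1 _ (dn _ he1)) //.
move: E1 E2 J; case: (above q _ z); case: (path_parity _ _ _); case: (path_parity _ _ _);
case: (path_parity _ _ _); case: (above _ _ _); by case: (above _ _ _).
Qed.

End loops.

End loop_parities.

(** * Independence of the loop parities over the field with two elements *)

Section independent_loops.
Implicit Types (a b c q x y z w : pt) (d e r s t u : R).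

Lemma box_vertical e z r : `|r| < e -> box e z (z.1, z.2 + r).
Proof.
move=> re; have := normr_ge0 r; move: re; rewrite ltr_norml => /andP[? ?] ?.
by split => /=; lra.
Qed.

Section lower_bound.
(** [G] collects the pairs whose common points close loops; sides 0 and [N - 1], which share a
    corner, may be such a pair. The sides asked to be non-vertical are those that can be the larger
    member of a pair; side 0 is vertical in the extremal curves for odd [N]. *)
Variables (N : nat) (p : 'I_N -> pt) (G : {set 'I_N * 'I_N}).
Hypotheses (N0 : (0 < N)%N) (adm : admissible p)
  (neq_next : forall i, p i <> p (nexti i))
  (simple_crossings : forall i j k x, i != j -> j != k -> i != k ->
     side p i x -> side p j x -> side p k x -> False)
  (nonvertical : forall i : 'I_N, (0 < i)%N -> (p i).1 != (p (nexti i)).1)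
  (gap : forall ji, ji \in G -> (ji.1.+1 < ji.2)%N)
  (meet : forall ji, ji \in G -> side p ji.1 `&` side p ji.2 !=set0).

Let P n := p (cyc N0 n).
Let crossing (ji : 'I_N * 'I_N) : pt := xget (0, 0) (side p ji.1 `&` side p ji.2).
Let w (ji : 'I_N * 'I_N) : pt -> bool := loop_parity P (crossing ji) ji.1 ji.2.

Lemma side_cyc (k : nat) : side p (cyc N0 k) = segment (P k) (P k.+1).
Proof. by rewrite /side cyc_next. Qed.

Lemma side_val (i : 'I_N) : side p i = segment (P i) (P i.+1).
Proof. by rewrite -side_cyc cyc_val. Qed.

Lemma crossingP ji : ji \in G -> side p ji.1 (crossing ji) /\ side p ji.2 (crossing ji).
Proof. by move=> /meet[x hx]; have [] := xgetPex (0, 0) (ex_intro _ x hx). Qed.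

(** At parameter 0 the point would be a corner, common to three distinct sides. Parameter 1 does
    occur, when sides 0 and [N - 1] meet at corner 0. *)
Lemma crossing_param ji : ji \in G -> exists2 t, 0 < t <= 1 &
  crossing ji = gam (p ji.2) (p (nexti ji.2)) t.
Proof.
move=> jiG; have [cj [t [/andP[t0 t1] ct]]] := crossingP jiG; exists t => //.
rewrite lt0r t0 t1 !andbT; apply/eqP => tz.
have cp : crossing ji = p ji.2 by rewrite ct tz -/(gam _ _ 0) gam0.
have gji := gap jiG.
have j0 : (0 < ji.2)%N by apply: leq_ltn_trans gji.
have i1N : (ji.2.-1 < N)%N by rewrite prednK // ltnW.
have nx : nexti (Ordinal i1N) = ji.2.
  by apply: val_inj; rewrite /= prednK ?modn_small.
apply: (@simple_crossings ji.1 ji.2 (Ordinal i1N) (p ji.2)).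
- by rewrite -(inj_eq val_inj) /= neq_ltn (ltnW gji).
- by rewrite -(inj_eq val_inj) /= -{1}(prednK j0) neq_ltn ltnSn orbT.
- by rewrite -(inj_eq val_inj) /= neq_ltn -ltnS prednK // gji.
- by rewrite -cp.
- exact: segment_left.
- by rewrite -{2}nx; exact: segment_right.
Qed.

Lemma loop_sub_sides (ji : 'I_N * 'I_N) : ji \in G ->
  segment (crossing ji) (P ji.1.+1) `<=` side p ji.1 /\
  segment (P ji.2) (crossing ji) `<=` side p ji.2.
Proof.
move=> jiG; have [h1 h2] := crossingP jiG; split.
  by apply: segment_sub => //; rewrite -/(side p ji.1) side_val; exact: segment_right.
by apply: segment_sub => //; rewrite /P cyc_val; exact: segment_left.
Qed.

Lemma between_sides (ji : 'I_N * 'I_N) (k : nat) x : (ji.1 < k < ji.2)%N ->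
  segment (P k) (P k.+1) x -> exists2 i : 'I_N, (ji.1 < i < ji.2)%N & side p i x.
Proof.
move=> /andP[k1 k2] h; have kN := ltn_trans k2 (ltn_ord ji.2).
by exists (Ordinal kN); rewrite ?side_val //= k1.
Qed.

Lemma w_local ji x0 : ji \in G -> ~ curve p x0 ->
  exists2 e : R, 0 < e & forall x, box e x0 x -> w ji x = w ji x0.
Proof.
move=> jiG nx; have [s1 s2] := loop_sub_sides jiG.
apply: loop_local.
- exact: ltnW (gap jiG).
- by move=> /s1 h; apply: nx; exists ji.1.
- by move=> k kk /(between_sides kk)[i _ h]; apply: nx; exists i.
- by move=> /s2 h; apply: nx; exists ji.2.
Qed.

Let wsum (T : {set 'I_N * 'I_N}) x := \big[addb/false]_(ji in T) w ji x.

Lemma wsum_local (T : {set 'I_N * 'I_N}) x0 : T \subset G -> ~ curve p x0 ->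
  exists2 e : R, 0 < e & forall x, box e x0 x -> wsum T x = wsum T x0.
Proof.
move=> /fintype.subsetP TG nx.
have [| |e e0 h] := @finite_pos _ (mem T) (fun ji e => forall x, box e x0 x -> w ji x = w ji x0).
- by move=> ji e e' h _ ee x xb; apply: h; exact: box_sub xb.
- by move=> ji jiT; apply: w_local => //; exact: TG.
by exists e => // x xb; apply: eq_bigr => ji jiT; exact: h.
Qed.

Lemma wsum_bounded (T : {set 'I_N * 'I_N}) : T \subset G ->
  bounded_pt [set x | wsum T x].
Proof.
move=> /fintype.subsetP TG; have [M hM] := curve_bounded p.
exists M => x /= wx; apply: contrapT => h.
move: wx; rewrite /wsum big1 // => ji jiT.
have jiG := TG _ jiT; have [c1 _] := crossingP jiG.
have [] : [/\ - M < (crossing ji).1, (crossing ji).1 < M, - M < (crossing ji).2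
    & (crossing ji).2 < M] by apply: hM; exists ji.1.
move=> h1 h2 h3 h4; apply: (@loop_far P M); rewrite ?h1 ?h2 ?h3 ?h4 //.
- exact: ltnW (gap jiG).
- move=> k; have [] := hM (P k); first by exists (cyc N0 k) => //; exact: segment_left.
  by move=> -> -> -> ->.
apply/negP => /and4P[k1 k2 k3 k4]; apply: h.
by split; rewrite ler_norml; apply/andP; split; exact: ltW.
Qed.

(* Just before the crossing which comes last along the side of largest index,
   exactly one of the loops has an edge. *)
Lemma wsum_nonzero (T : {set 'I_N * 'I_N}) : T \subset G -> T != finset.set0 ->
  exists2 x, ~ curve p x & wsum T x.
Proof.
move=> /fintype.subsetP TG Tn0.
have /choice[tau htau] : forall ji, exists t, ji \in G ->
    0 < t <= 1 /\ crossing ji = gam (p ji.2) (p (nexti ji.2)) t.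
  move=> ji; case: (boolP (ji \in G)) => [/crossing_param[t t0 ct]|_]; last by exists 0.
  by exists t.
have [ji [jiT jimax]] : exists ji, ji \in T /\ forall kl, kl \in T -> (kl.2 <= ji.2)%N /\
    (kl.2 = ji.2 -> tau kl <= tau ji).
  (* As [tau] takes values in (0, 1], twice the index plus [tau] encodes the lexicographic order;
     the sign turns the maximum into a minimum. *)
  pose mu (kl : 'I_N * 'I_N) : R := - (2 * (kl.2)%:R + tau kl).
  have [|m] := @min_in_seq [seq mu kl | kl <- enum T].
    move/set0Pn : Tn0 => [kl klT]; apply/eqP => E.
    have : mu kl \in [seq mu kl | kl <- enum T] by apply: map_f; rewrite mem_enum.
    by rewrite E.
  case/mapP => ji; rewrite mem_enum => jiT -> mmin; exists ji; split=> // kl klT.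
  have : mu ji <= mu kl by apply: mmin; apply: map_f; rewrite mem_enum.
  have [/andP[t0 t1] _] := htau _ (TG _ jiT); have [/andP[u0 u1] _] := htau _ (TG _ klT).
  rewrite /mu lerN2 => h; split; last by move=> E; rewrite E in h; lra.
  rewrite leqNgt; apply/negP => lt.
  have : (ji.2.+1)%:R <= (kl.2)%:R :> R by rewrite ler_nat.
  by rewrite -natr1 => h'; lra.
have jiG := TG _ jiT; have [t01 ct] := htau _ jiG; have gji := gap jiG.
set i := ji.2 in t01 ct jimax gji *; set T0 := tau ji in t01 ct jimax *.
have [t0 t1] := andP t01.
have inj := @gam_inj (p i) (p (nexti i)) _ _ (@neq_next i).
pose z t := gam (p i) (p (nexti i)) t.
have zi t : 0 <= t <= 1 -> side p i (z t) by move=> ?; exact: gam_segment.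
(* Another side meets side [i] at most once, so it misses a short stretch just before [T0]. *)
have [|k ki|d1 d10 H1] := @finite_pos _ [pred k : 'I_N | k != i]
   (fun k d => forall t, 0 <= t -> T0 - d < t -> t < T0 -> ~ side p k (z t)).
- by move=> k d d' h _ dd t tt h1 h2; apply: h => //; lra.
- case: (pselect (exists2 t, 0 <= t < T0 & side p k (z t))) => [[s /andP[s0 s1] hs]|ns].
    exists (T0 - s); first by lra.
    move=> t tt h1 h2 h; have : z t = z s.
      apply: (side_unique adm (i := i) (j := k)) => //.
      - by apply/eqP; rewrite eq_sym.
      - by apply: zi; apply/andP; split; lra.
      - by apply: zi; apply/andP; split; lra.
    by move/inj => E; lra.
  by exists 1 => // t tt h1 h2 h; apply: ns; exists t => //; rewrite tt.
(* Another pair of [T] on side [i] cannot have parameter [T0] too, since three sides would be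
   concurrent; so all of them come at least [d2] earlier. *)
have [|kl|d2 d20 H2] := @finite_pos _ [pred kl | (kl \in T) && (kl.2 == i) && (kl != ji)]
   (fun kl d => tau kl <= T0 - d).
- by move=> kl d d' h _ dd; lra.
- rewrite !inE => /andP[/andP[klT /eqP kli] klji]; exists (T0 - tau kl); last by lra.
  have [_ le] := jimax _ klT; rewrite subr_gt0 lt_neqAle le // andbT.
  apply/eqP => E; have [_ ckl] := htau _ (TG _ klT).
  have [k1 _] := crossingP (TG _ klT); have [j1 j2] := crossingP jiG.
  have same : crossing kl = crossing ji by rewrite ckl ct kli E.
  have gkl := gap (TG _ klT).
  apply: (@simple_crossings kl.1 ji.1 i (crossing ji)) => //; last by rewrite -same.
  + apply: contra_neq klji => E1; apply/eqP; rewrite -pair_eqE /pair_eq /= E1 eqxx /=.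
    exact/eqP.
  + by rewrite -(inj_eq val_inj) /= neq_ltn (ltnW gji).
  + by rewrite -kli -(inj_eq val_inj) /= neq_ltn (ltnW gkl).
pose m := Num.min T0 (Num.min d1 d2).
have m0 : 0 < m by rewrite !lt_min t0 d10.
have mT : m <= T0 by rewrite ge_min lexx.
have md1 : m <= d1 by rewrite !ge_min lexx ?orbT.
have md2 : m <= d2 by rewrite !ge_min lexx ?orbT.
pose t := T0 - m / 2.
have zk (k : 'I_N) : k != i -> ~ side p k (z t) by move=> ki; apply: H1 => //; rewrite /t; lra.
have iv : (p i).1 != (p (nexti i)).1 by apply: nonvertical; apply: leq_ltn_trans gji.
have neq (kl : 'I_N * 'I_N) (k : 'I_N) : kl \in T -> (k < kl.2)%N -> k != i.
  move=> klT kkl; rewrite -(inj_eq val_inj) /= neq_ltn.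
  by rewrite (leq_trans kkl) //; have [] := jimax _ klT.
have away1 kl : kl \in T -> ~ segment (crossing kl) (P kl.1.+1) (z t).
  move=> klT h; have [s1 _] := loop_sub_sides (TG _ klT).
  by apply: (zk kl.1 _ (s1 _ h)); apply: (neq kl) => //; exact: ltnW (gap (TG _ klT)).
have away2 kl : kl \in T -> forall k, (kl.1 < k < kl.2)%N -> ~ segment (P k) (P k.+1) (z t).
  move=> klT k kk /(between_sides kk)[k' /andP[_ k2] h].
  by apply: (zk k' _ h); exact: (neq kl).
(* The other loops that end on side [i] leave it at an earlier parameter than [t]. *)
have away3 kl : kl \in T -> kl != ji -> ~ segment (P kl.2) (crossing kl) (z t).
  move=> klT klji h; case: (eqVneq kl.2 i) => [kli|kli]; last first.
    by have [_ s2] := loop_sub_sides (TG _ klT); exact: (zk _ kli (s2 _ h)).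
  have [_ ckl] := htau _ (TG _ klT).
  move: h; rewrite ckl kli /P cyc_val -{1}(gam0 (p i) (p (nexti i))) => /gam_sub[s [/inj <-]].
  have := H2 kl; rewrite !inE klT kli eqxx klji => /(_ isT) h _.
  have [/andP[u0 _] _] := htau _ (TG _ klT).
  by rewrite le_max => /orP[]; rewrite /t => ?; lra.
have [|kl|e1 e10 K1] := @finite_pos _ [pred kl | (kl \in T) && (kl != ji)]
   (fun kl e => forall x, box e (z t) x -> w kl x = w kl (z t)).
- by move=> kl e e' h _ ee x xb; apply: h; exact: box_sub xb.
- rewrite !inE => /andP[klT klji]; apply: loop_local.
  + exact: ltnW (gap (TG _ klT)).
  + exact: away1.
  + exact: away2.
  + exact: away3.
have [|k ki|e2 e20 K2] := @finite_pos _ [pred k : 'I_N | k != i]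
   (fun k e => forall x, box e (z t) x -> ~ side p k x).
- by move=> k e e' h _ ee x xb; apply: h; exact: box_sub xb.
- by apply: closed_avoid_box; [exact: segment_closed_pt|exact: zk].
have zt : z t = gam (P i) (crossing ji) (t / T0).
  rewrite ct /P cyc_val /z /gam /=; congr pair; field; exact: lt0r_neq0.
have [|||||e3 e30 K3] := @loop_jump P (crossing ji) ji.1 i (t / T0).
- exact: ltnW.
- rewrite ct /P cyc_val /gam /= -subr_eq0 opprD addrA subrr add0r oppr_eq0 mulf_eq0.
  by rewrite subr_eq0 negb_or (gt_eqF t0) eq_sym iv.
- by rewrite ltr_pdivrMr // ltr_pdivlMr // /t; apply/andP; split; lra.
- by rewrite -zt; exact: away1.
- by rewrite -zt; exact: away2.
rewrite -zt in K3.
pose e := Num.min e1 (Num.min e2 e3); have e0 : 0 < e by rewrite !lt_min e10 e20.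
have ee1 : e <= e1 by rewrite ge_min lexx.
have ee2 : e <= e2 by rewrite !ge_min lexx ?orbT.
have ee3 : e <= e3 by rewrite !ge_min lexx ?orbT.
pose h := e / 2.
have h0 : 0 < h by exact: divr_gt0.
have he : h < e by rewrite ltr_pdivrMr // ltr_pMr // ltr1n.
have off k : `|k| = h -> ~ curve p ((z t).1, (z t).2 + k).
  move=> kh [l _ hl].
  have kb : box e (z t) ((z t).1, (z t).2 + k) by apply: box_vertical; rewrite kh.
  case: (eqVneq l i) => [li|li]; last by exact: (K2 l li _ (box_sub ee2 kb)).
  have := segment_orient hl; rewrite li.
  have -> : orient (p i) (p (nexti i)) ((z t).1, (z t).2 + k) = ((p (nexti i)).1 - (p i).1) * k.
    by rewrite /orient /z /gam /=; ring.
  move/eqP; rewrite mulf_eq0 subr_eq0 eq_sym (negbTE iv) /= => /eqP k0.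
  by move: h0; rewrite -kh k0 normr0 ltxx.
(* Only the loop of [ji] changes between the points above and below [z t], so the sum is 1 at one of
   them. *)
have jump : wsum T ((z t).1, (z t).2 + h) (+) wsum T ((z t).1, (z t).2 - h).
  rewrite /wsum -big_split /= (bigD1 ji) //= big1.
    by rewrite addbF; apply: K3 => //; exact: lt_le_trans ee3.
  move=> kl /andP[klT klji].
  have K1' := K1 kl; rewrite !inE klT klji in K1'.
  by rewrite !K1' ?addbb //; apply: (box_sub ee1); apply: box_vertical;
    rewrite ?normrN gtr0_norm.
case: (boolP (wsum T ((z t).1, (z t).2 + h))) => [W|W].
  by exists ((z t).1, (z t).2 + h) => //; apply: off; rewrite gtr0_norm.
exists ((z t).1, (z t).2 - h); first by apply: off; rewrite normrN gtr0_norm.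
by move: jump; rewrite (negbTE W).
Qed.

(** If two subsets of [G] gave the same parities on all bounded components, the sum over their
    symmetric difference would vanish there. But that sum is constant on components, zero far away,
    and nonzero somewhere. Hence [2 ^ #|G|] is at most [2 ^ k]. *)
Lemma crossings_le_components k : has_card (bounded_components p) k -> (#|G| <= k)%N.
Proof.
case=> f [finj fim].
have rep (r : 'I_k) : exists x, ~ curve p x /\ f r = connected_component (~` curve p) x.
  have : (f @` setT) (f r) by exists r.
  by rewrite fim => -[x [nx [-> _]]]; exists x.
have [x hx] := choice rep.
pose phi T : {ffun 'I_k -> bool} := [ffun r => wsum T (x r)].
have phi_inj : {in powerset G &, injective phi}.
  move=> T T'; rewrite !powersetE => TG TG' E; apply/eqP/negPn/negP => nT.
  pose D := [set ji | (ji \in T) (+) (ji \in T')]%SET.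
  have DG : D \subset G.
    apply/fintype.subsetP => ji; rewrite finset.in_set.
    by case: (boolP (ji \in T)) => [/(fintype.subsetP TG)//|_ /(fintype.subsetP TG')].
  have Dn0 : D != finset.set0.
    apply: contraNneq nT => D0; apply/eqP/setP => ji.
    have : ji \notin D by rewrite D0 finset.in_set0.
    by rewrite finset.in_set; case: (ji \in T); case: (ji \in T').
  have wD y : wsum D y = wsum T y (+) wsum T' y.
    rewrite /wsum big_mkcond [X in _ = X (+) _]big_mkcond [X in _ = _ (+) X]big_mkcond -big_split /=; apply: eq_bigr => ji _.
    by rewrite finset.in_set; case: (ji \in T); case: (ji \in T'); rewrite /= ?addbF ?addbb.
  have [y ny wy] := wsum_nonzero DG Dn0.
  have const z z' : conn (curve p) z z' -> wsum D z -> wsum D z'.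
    move=> zz'.
    have Czz : connected_component (~` curve p) z z.
      by apply: conn_refl; apply: (@conn_avoid _ z'); exact: conn_sym.
    have loc (u : pt) : connected_component (~` curve p) z u -> exists2 e : R, 0 < e &
        forall u' : pt, connected_component (~` curve p) z u' -> box e u u' ->
        (wsum D u' <-> wsum D u).
      move=> /conn_avoid nu; have [e e0 h] := wsum_local DG nu.
      by exists e => // u' _ /h ->.
    exact: (locally_const_connected (@component_connected _ (~` curve p) z) loc Czz zz').
  have : bounded_components p (connected_component (~` curve p) y).
    exists y; split=> //; split=> //; have [M hM] := wsum_bounded DG.
    by exists M => u yu; apply: hM; exact: const yu wy.
  rewrite -fim => -[r _ fr]; have [nr fr'] := hx r.
  have yr : conn (curve p) y (x r).
    by rewrite /conn -fr fr'; exact: conn_refl.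
  have := const _ _ yr wy; rewrite wD.
  by move/ffunP/(_ r): E; rewrite !ffunE => ->; rewrite addbb.
have : (#|powerset G| <= #|{ffun 'I_k -> bool}|)%N.
  by rewrite -(card_in_imset phi_inj); exact: max_card.
by rewrite card_powerset card_ffun card_bool card_ord leq_exp2l.
Qed.

End lower_bound.

End independent_loops.

(** * Extremal curves *)

Section tangent_lines.
Implicit Types (a b u t : R).

(* The lines [y = (a^2 + 1) u - 2 a] are tangent to a common conic: those of
   parameters [a] and [b] meet at abscissa [2 / (a + b)], so no three of them
   are concurrent. *)
Definition tangent a u := (a ^+ 2 + 1) * u - 2 * a.

Definition on_tangent a u : pt := (u, tangent a u).

Lemma tangent_meet a b u : a != b -> tangent a u = tangent b u <-> (a + b) * u = 2.
Proof.
move=> ab; have ab0 : a - b != 0 by rewrite subr_eq0.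
have E : tangent a u - tangent b u = (a - b) * ((a + b) * u - 2) by rewrite /tangent; ring.
split=> h; last by apply/eqP; rewrite -subr_eq0 E h subrr mulr0.
move/eqP: E; rewrite h subrr eq_sym mulf_eq0 (negbTE ab0) /= => /eqP; lra.
Qed.

Lemma tangent_gam a u : on_tangent a u = gam (on_tangent a 0) (on_tangent a 1) u.
Proof. by rewrite /on_tangent /tangent /gam /=; congr pair; ring. Qed.

Lemma segment_tangent a s t (x : pt) : segment (on_tangent a s) (on_tangent a t) x ->
  x.2 = tangent a x.1.
Proof. by case=> r [_ ->]; rewrite /on_tangent /tangent /=; ring. Qed.

Lemma tangent_segment a s t u : s * t < 0 -> `|u| <= `|s| -> `|u| <= `|t| ->
  segment (on_tangent a s) (on_tangent a t) (on_tangent a u).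
Proof.
move=> st; wlog s0 : s t st / s < 0.
  move=> H us ut; case: (ltP s 0) => s0; first exact: H.
  rewrite segmentC; apply: H => //; first by rewrite mulrC.
  by rewrite ltNge; apply/negP => t0; move: st; rewrite ltNge mulr_ge0.
have t0 : 0 < t by rewrite nmulr_rlt0 in st.
rewrite (ltr0_norm s0) (gtr0_norm t0) !ler_norml => /andP[h1 _] /andP[_ h2].
rewrite !(tangent_gam _ s, tangent_gam _ t, tangent_gam _ u).
by apply: gam_between; [exact: lt_trans t0|apply/andP; split => //; lra].
Qed.

Definition alternating (k : nat) : R := if odd k then -1 else 1.

Section zigzag.
Variables (N : nat) (v : nat -> R) (al be ka : R) (closing : pt -> Prop).
Hypothesis N3 : (3 <= N)%N.

Local Notation sg := alternating.
Let st k := if k == 1%N then al else - sg k.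
Let en k := if k == N.-1 then be else sg k.

(* Side 0 closes a path whose [k]-th side lies on the tangent of parameter [v k]
   and goes from abscissa [(-1)^(k-1)] to [(-1)^k], except at the two free ends of
   the path, of abscissas [al] and [be]. *)
Definition zigzag (i : 'I_N) : pt :=
  if (i == 0 :> nat)%N then on_tangent (v N.-1) be else on_tangent (v i) (st i).

(** By [v_next], consecutive tangents meet at abscissa [sg k]. The conditions on [al] and [be] make
    every side of positive index cover the abscissas from [-ka] to [ka]. The set [closing] stands
    for the line of side 0, given by an equation. *)
Hypotheses (ka0 : 2^-1 <= ka) (ka1 : ka <= 1) (alk : ka <= al) (bek : ka <= be * sg N.-1)
  (v_next : forall k, (0 < k)%N -> (k.+1 < N)%N -> v k + v k.+1 = 2 * sg k)
  (v_inj : forall i j, (0 < i < N)%N -> (0 < j < N)%N -> i != j -> v i != v j)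
  (closing_side : segment (on_tangent (v N.-1) be) (on_tangent (v 1) al) `<=` closing)
  (closing_line : forall k (x y : pt), (0 < k < N)%N -> closing x -> x.2 = tangent (v k) x.1 ->
     closing y -> y.2 = tangent (v k) y.1 -> x = y)
  (closing_lines : forall i j (x : pt), (0 < i < N)%N -> (0 < j < N)%N -> i != j ->
     closing x -> x.2 = tangent (v i) x.1 -> x.2 = tangent (v j) x.1 -> False).

Let p := zigzag.

Lemma sg_sqr k : sg k * sg k = 1.
Proof. by rewrite /alternating; case: odd; lra. Qed.

Lemma zigzag_side (k : 'I_N) : (0 < k)%N ->
  side p k = segment (on_tangent (v k) (st k)) (on_tangent (v k) (en k)).
Proof.
move=> k0; rewrite /side /p {1}/zigzag -[(k == 0 :> nat)%N]negbK -lt0n k0 /=.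
congr segment; rewrite /zigzag /= /en; have := ltn_ord k; rewrite leq_eqVlt => /orP[/eqP kN|kN].
  by rewrite kN modnn /= -[X in X.-1]kN eqxx /=; congr on_tangent; congr v; rewrite -[in RHS]kN.
rewrite modn_small //= (_ : k == N.-1 :> nat = false); last by apply/negbTE; lia.
rewrite /st eqSS -[(k == 0 :> nat)%N]negbK -lt0n k0 /= {1}/alternating /= -/(sg k).
have -> : - (if ~~ odd k then -1 else 1) = sg k by rewrite /alternating; case: odd; rewrite //= opprK.
congr pair; apply/esym/tangent_meet; first by apply: v_inj; lia.
by rewrite v_next // -mulrA sg_sqr mulr1.
Qed.

Lemma zigzag_side0 (k : 'I_N) : (k = 0 :> nat)%N ->
  side p k = segment (on_tangent (v N.-1) be) (on_tangent (v 1) al).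
Proof.
move=> k0; rewrite /side /p /zigzag k0 /= k0.
have -> : (1 %% N = 1)%N by apply: modn_small; lia.
by rewrite /= /st.
Qed.

Lemma zigzag_line (k : 'I_N) x : (0 < k)%N -> side p k x -> x.2 = tangent (v k) x.1.
Proof. by move=> k0; rewrite zigzag_side // => /segment_tangent. Qed.

Lemma zigzag_closing (k : 'I_N) x : (k = 0 :> nat)%N -> side p k x -> closing x.
Proof. by move=> k0; rewrite zigzag_side0 //; exact: closing_side. Qed.

Lemma ends (k : nat) : (0 < k < N)%N ->
  [/\ st k * en k < 0, ka <= `|st k| & ka <= `|en k|].
Proof.
move=> /andP[k0 kN].
have kp : 0 < ka by apply: lt_le_trans ka0; rewrite invr_gt0.
have sgn : `|sg k| = 1 by rewrite /alternating; case: odd; rewrite ?normrN normr1.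
have h1 : ka <= - sg k * st k.
  rewrite /st; case: eqP => [->|_]; first by rewrite /alternating /= opprK mul1r.
  by rewrite mulrNN sg_sqr.
have h2 : ka <= sg k * en k.
  rewrite /en; case: eqP => [->|_]; first by rewrite mulrC.
  by rewrite sg_sqr.
have aux (s t : R) : `|s| = 1 -> ka <= s * t -> ka <= `|t|.
  by move=> s1 h; apply: (le_trans h); rewrite -[X in _ <= X]mul1r -s1 -normrM ler_norm.
split; last by apply: aux h2.
  have : 0 < (- sg k * st k) * (sg k * en k) by apply: mulr_gt0; exact: lt_le_trans kp _.
  rewrite (_ : _ * _ = - (sg k * sg k) * (st k * en k)); last by ring.
  by rewrite sg_sqr mulN1r oppr_gt0.
by apply: aux h1; rewrite normrN.
Qed.

Lemma tangent_on_side (k : 'I_N) u : (0 < k)%N -> `|u| <= ka -> side p k (on_tangent (v k) u).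
Proof.
move=> k0 uk; rewrite zigzag_side //; have [|h1 h2 h3] := @ends k; first by rewrite k0 ltn_ord.
by apply: tangent_segment => //; exact: le_trans uk _.
Qed.

Lemma three_lines i j k (x : pt) : (0 < i < N)%N -> (0 < j < N)%N -> (0 < k < N)%N ->
  i != j -> j != k -> i != k -> x.2 = tangent (v i) x.1 -> x.2 = tangent (v j) x.1 ->
  x.2 = tangent (v k) x.1 -> False.
Proof.
move=> iN jN kN ij jk ik xi xj xk.
have /tangent_meet h1 := etrans (esym xi) xj; have /tangent_meet h2 := etrans (esym xi) xk.
have {}h1 := h1 (v_inj iN jN ij); have {}h2 := h2 (v_inj iN kN ik).
have x0 : x.1 != 0 by apply/eqP => E; move: h1; rewrite E; lra.
have /eqP : (v j - v k) * x.1 = 0 by lra.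
by rewrite mulf_eq0 (negbTE x0) orbF subr_eq0; apply/negP; exact: v_inj.
Qed.

Lemma zigzag_simple (i j k : 'I_N) x : i != j -> j != k -> i != k ->
  side p i x -> side p j x -> side p k x -> False.
Proof.
rewrite -!(inj_eq val_inj) /= => ij jk ik hi hj hk.
have pos (l : 'I_N) : (0 < l)%N -> (0 < l < N)%N by move=> ->; rewrite ltn_ord.
have L (l : 'I_N) : (0 < l)%N -> side p l x -> x.2 = tangent (v l) x.1 := @zigzag_line l x.
have C (l : 'I_N) : l = 0%N :> nat -> side p l x -> closing x := @zigzag_closing l x.
case: (posnP i) => i0.
  apply: (@closing_lines j k x) => //; try (by apply: pos; lia); first exact: C hi.
    by apply: L => //; lia.
  by apply: L => //; lia.
case: (posnP j) => j0.
  apply: (@closing_lines i k x) => //; try (by apply: pos; lia); first exact: C hj.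
    by apply: L => //; lia.
  by apply: L => //; lia.
case: (posnP k) => k0.
  apply: (@closing_lines i j x) => //; try (by apply: pos; lia); first exact: C hk.
    by apply: L => //; lia.
  by apply: L => //; lia.
exact: (three_lines (pos _ i0) (pos _ j0) (pos _ k0) ij jk ik
  (L _ i0 hi) (L _ j0 hj) (L _ k0 hk)).
Qed.

(** If two corners coincided, three of the sides ending there would be concurrent. Two sides on
    distinct tangents meet at most at the abscissa given by [tangent_meet]. *)
Lemma zigzag_admissible : admissible p.
Proof.
have prev (j : 'I_N) : exists2 h : 'I_N, nexti h = j & side p h (p j).
  exists (ord_pred j); first exact: ord_predK.
  by rewrite -{2}(ord_predK j); exact: segment_right.
have next1 (j : 'I_N) : nexti j != j.
  rewrite -(inj_eq val_inj) /=; have := ltn_ord j; rewrite leq_eqVlt => /orP[/eqP jN|jN].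
    by rewrite jN modnn; lia.
  by rewrite modn_small //; lia.
have next2 (j : 'I_N) : nexti (nexti j) != j.
  rewrite -(inj_eq val_inj) /= -addn1 modnDml addn1; have := ltn_ord j.
  case: (ltnP j.+2 N) => h jN; first by rewrite modn_small //; lia.
  have [E|E] : j.+2 = N \/ j.+2 = N.+1 by lia.
    by rewrite E modnn; lia.
  by rewrite E -addn1 modnDl modn_small; lia.
have self (j : 'I_N) : side p j (p j) by exact: segment_left.
split.
  move=> i j E; apply/eqP/negPn/negP => ij.
  have [i' i'i hi'] := prev i; have [j' j'j hj'] := prev j.
  case: (eqVneq i' j) => [i'j|i'j].
    apply: (@zigzag_simple i j j' (p i)) => //; rewrite ?E //.
    - by rewrite -j'j next1.
    - by rewrite -i'i i'j -j'j next2.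
  apply: (@zigzag_simple i' i j (p i)) => //; rewrite ?E //.
  by rewrite -i'i eq_sym next1.
move=> i j /eqP; rewrite -(inj_eq val_inj) /= => ij x y xi xj yi yj.
have pos (l : 'I_N) : (0 < l)%N -> (0 < l < N)%N by move=> ->; rewrite ltn_ord.
case: (posnP i) => i0.
  have j0 : (0 < j)%N by lia.
  apply: (@closing_line j); rewrite ?pos //; try exact: (@zigzag_closing i);
    exact: zigzag_line.
case: (posnP j) => j0.
  apply: (@closing_line i); rewrite ?pos //; try exact: (@zigzag_closing j);
    exact: zigzag_line.
have vij := v_inj (pos i i0) (pos j j0) ij.
have := etrans (esym (zigzag_line i0 xi)) (zigzag_line j0 xj) => /(tangent_meet _ vij) hx.
have := etrans (esym (zigzag_line i0 yi)) (zigzag_line j0 yj) => /(tangent_meet _ vij) hy.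
have s0 : v i + v j != 0 by apply/eqP => E; move: hx; rewrite E; lra.
have xy1 : x.1 = y.1 by apply: (mulfI s0); rewrite hx hy.
have := zigzag_line i0 xi; rewrite xy1 -(zigzag_line i0 yi).
by case: x y xy1 {xi xj yi yj hx hy} => [x1 x2] [y1 y2] /= -> ->.
Qed.

(** The two tangents meet at an abscissa of absolute value at most 1/2, which both sides cover. *)
Lemma zigzag_meet (j i : 'I_N) : (0 < j)%N -> (0 < i)%N -> j != i -> 4 <= `|v j + v i| ->
  side p j `&` side p i !=set0.
Proof.
move=> j0 i0 ji h; pose u := 2 / (v j + v i).
have s0 : v j + v i != 0 by apply/eqP => E; move: h; rewrite E normr0; lra.
have uk : `|u| <= ka.
  apply: le_trans ka0; rewrite normrM normfV ler_pdivrMr ?normr_gt0 // gtr0_norm //; lra.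
exists (on_tangent (v j) u); split; first exact: tangent_on_side.
have -> : on_tangent (v j) u = on_tangent (v i) u; last exact: tangent_on_side.
congr pair; apply/tangent_meet; last by rewrite /u mulrC divfK.
by apply: v_inj; rewrite ?j0 ?i0 ?ltn_ord //; rewrite (inj_eq val_inj).
Qed.

Lemma zigzag_components (G : {set 'I_N * 'I_N}) k :
  (forall i : 'I_N, (1 < i < N.-1)%N -> exists2 u, `|u| <= ka &
     segment (on_tangent (v N.-1) be) (on_tangent (v 1) al) (on_tangent (v i) u)) ->
  (forall ji, ji \in G -> (ji.1.+1 < ji.2)%N /\
     ((0 < ji.1)%N -> 4 <= `|v ji.1 + v ji.2|)) ->
  has_card (bounded_components p) k -> (#|G| <= k)%N.
Proof.
move=> meet0 hG; have N0 : (0 < N)%N by exact: leq_trans N3.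
have adm := zigzag_admissible.
apply: (crossings_le_components N0 adm (@next_neq N p N3 adm) zigzag_simple).
(* A side of positive index is not vertical because its ends have abscissas of opposite signs. *)
- move=> i i0; have := @next_neq N p N3 adm i.
  have iN : (0 < i < N)%N by rewrite i0 ltn_ord.
  have [se _ _] := ends iN; have := zigzag_side i0; rewrite /side.
  have -> : p i = on_tangent (v i) (st i).
    by rewrite /p /zigzag -[(i == 0 :> nat)%N]negbK -lt0n i0.
  move=> E _; have : segment (on_tangent (v i) (st i)) (on_tangent (v i) (en i)) (p (nexti i)).
    by rewrite -E; exact: segment_right.
  have : segment (on_tangent (v i) (st i)) (p (nexti i)) (on_tangent (v i) (en i)).
    by rewrite E; exact: segment_right.
  move=> [t [_ /(congr1 fst) /= h]] _; apply/eqP => E'; rewrite -E' subrr mulr0 addr0 in h.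
  by move: se; rewrite h ltNge -expr2 sqr_ge0.
- by move=> ji /hG[].
- move=> [j i] /hG /= [ji h]; case: (posnP j) => j0; last first.
    apply: zigzag_meet => //; last exact: h.
      by apply: leq_ltn_trans ji.
    by rewrite -(inj_eq val_inj) /= neq_ltn (ltnW ji).
  have i0 : (0 < i)%N by apply: leq_ltn_trans ji.
  case: (eqVneq (i : nat) N.-1) => [iN|iN].
    exists (on_tangent (v N.-1) be); rewrite zigzag_side0 // zigzag_side //; split.
      exact: segment_left.
    by rewrite /en iN eqxx; exact: segment_right.
  have [|u uk hu] := meet0 i; first by move: ji (ltn_ord i) iN; rewrite j0; lia.
  exists (on_tangent (v i) u); split; first by rewrite zigzag_side0.
  exact: tangent_on_side.
Qed.

End zigzag.

End tangent_lines.

(** * Choice of the tangents for odd and for even numbers of sides *)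

Section extremal_curves.
Implicit Types (a b u t : R).

Lemma card_gap_pairs N : (0 < N)%N ->
  #|[set ji : 'I_N * 'I_N | (ji.1.+1 < ji.2)%N]%SET| = 'C(N.-1, 2).
Proof.
case: N => // n _; rewrite (@card_pairs _ (fun j i : 'I_n.+1 => (j.+1 < i)%N)) -bin2_sum.
rewrite big_ord_recl big1 ?add0n /=; last by move=> j.
rewrite big_mkord; apply: eq_bigr => i _.
rewrite (eq_bigl (fun j : 'I_n.+1 => (j < i)%N)) //.
rewrite -(big_ord_widen n.+1 (fun=> 1%N)) ?sum1_card ?card_ord //.
exact: leqW (ltnW (ltn_ord i)).
Qed.

Lemma card_antidiagonal N m : N = m.*2 ->
  (#|[set ji : 'I_N * 'I_N | (ji.1.+1 < ji.2)%N && (ji.1 + ji.2 == N)%N]%SET| <= m.-1)%N.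
Proof.
move=> Nm; have [m0|m0] := posnP m.
  rewrite m0 leqn0 cards_eq0; apply/eqP/setP => -[j i].
  by have := ltn_ord i; rewrite {2}Nm m0.
have h1 (k : 'I_m.-1) : (k.+1 < N)%N by have := ltn_ord k; rewrite Nm; lia.
have h2 (k : 'I_m.-1) : (N - k.+1 < N)%N by have := ltn_ord k; rewrite Nm; lia.
pose f (k : 'I_m.-1) : 'I_N * 'I_N := (Ordinal (h1 k), Ordinal (h2 k)).
rewrite -[X in (_ <= X)%N]card_ord -cardsT; apply: leq_trans (leq_imset_card f _).
apply/subset_leq_card/fintype.subsetP => -[j i]; rewrite finset.in_set /= => /andP[ji /eqP E].
have iN := ltn_ord i; have km : (j.-1 < m.-1)%N by lia.
apply/imsetP; exists (Ordinal km); first by rewrite finset.in_setT.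
by apply/eqP; rewrite xpair_eqE -!(inj_eq val_inj) /=; lia.
Qed.

(* [d] is 1 for [N] odd and [N] for [N] even. *)
Definition zigzag_slope (d : int) (k : nat) : int :=
  if odd k then 2 * k%:Z - d else d - 2 * k%:Z.

Lemma zigzag_slope_next d k : (zigzag_slope d k)%:~R + (zigzag_slope d k.+1)%:~R =
  2 * alternating k :> R.
Proof.
rewrite -intrD (_ : _ + _ = if odd k then -2 else 2 : int).
  by rewrite /alternating; case: odd; rewrite ?mulrN1 ?mulr1 ?intrN.
by rewrite /zigzag_slope /=; case: odd => /=; lia.
Qed.

(** Up to sign the sum is twice [j + i - m.*2], even and nonzero, for indices of the same parity,
    and twice [i - j], odd and at least 3, otherwise. *)
Lemma zigzag_slope_even m (i j : nat) : (j.+1 < i)%N -> (j + i != m.*2)%N ->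
  4 <= `|zigzag_slope m.*2 j + zigzag_slope m.*2 i|.
Proof.
move=> ji; rewrite /zigzag_slope => /eqP h.
have Ei := odd_double_half i; have Ej := odd_double_half j.
by move: Ei Ej; case: (odd i); case: (odd j) => /=; lia.
Qed.

Lemma extremal_odd m : (0 < m)%N -> exists p : 'I_(m.*2.+1) -> pt, admissible p /\
  forall k, has_card (bounded_components p) k -> (fmax m.*2.+1 <= k)%N.
Proof.
move=> m0; set N := m.*2.+1; have N3 : (3 <= N)%N by rewrite /N; lia.
pose v k : R := (zigzag_slope 1 k)%:~R.
(* Side 0 is put on the vertical line of abscissa 3/4. No two of the tangents meet there, since the
   sum of their parameters would be 8/3, which is not an integer. *)
pose q : R := 3 / 4.
pose closing (x : pt) := x.1 = q.
have v_inj i j : (0 < i < N)%N -> (0 < j < N)%N -> i != j -> v i != v j.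
  by rewrite /v eqr_int /zigzag_slope; case: (boolP (odd i)); case: (boolP (odd j)); lia.
have vsum i j : v i + v j = (zigzag_slope 1 i + zigzag_slope 1 j)%:~R by rewrite intrD.
have v1 : v 1%N = 1 by [].
have q1 : q <= 1 by rewrite /q; lra.
have q2 : 2^-1 <= q by rewrite /q; lra.
have sgN : q <= q * alternating N.-1 by rewrite /alternating /N /= odd_double mulr1.
have v_next k : (0 < k)%N -> (k.+1 < N)%N -> v k + v k.+1 = 2 * alternating k.
  by move=> _ _; exact: zigzag_slope_next.
have closing_side : segment (on_tangent (v N.-1) q) (on_tangent (v 1%N) q) `<=` closing.
  by move=> x [t [_ ->]]; rewrite /closing /= subrr mulr0 addr0.
have closing_line k (x y : pt) : (0 < k < N)%N -> closing x -> x.2 = tangent (v k) x.1 ->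
     closing y -> y.2 = tangent (v k) y.1 -> x = y.
  by case: x y => [x1 x2] [y1 y2]; rewrite /closing /= => _ -> -> -> ->.
have closing_lines i j (x : pt) : (0 < i < N)%N -> (0 < j < N)%N -> i != j ->
     closing x -> x.2 = tangent (v i) x.1 -> x.2 = tangent (v j) x.1 -> False.
  move=> iN jN ij cx xi xj.
  have := etrans (esym xi) xj => /(tangent_meet _ (v_inj _ _ iN jN ij)); rewrite cx vsum /q => h.
  have : ((zigzag_slope 1 i + zigzag_slope 1 j) * 3)%:~R = 8%:~R :> R.
    by rewrite intrM; lra.
  by move/eqP; rewrite eqr_int => /eqP; lia.
exists (zigzag v q q); split.
  exact: (zigzag_admissible N3 q2 q1 (lexx q) sgN v_next v_inj closing_side closing_line closing_lines).
move=> k hk; pose G := [set ji : 'I_N * 'I_N | (ji.1.+1 < ji.2)%N]%SET.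
have <- : #|G| = fmax N.
  by rewrite card_gap_pairs // fmax_odd // bin2 /N /= -!muln2; nia.
apply: (zigzag_components N3 q2 q1 (lexx q) sgN v_next v_inj closing_side closing_line
  closing_lines _ _ hk).
  move=> i /andP[i1 iN]; exists q; first by rewrite gtr0_norm // /q; lra.
  rewrite segmentC; apply: vertical_segment.
  (* At abscissa [q] the height is quadratic in the parameter with its minimum at 4/3. Among the
     integers it is least at [v 1 = 1], and among the parameters in use it is largest at [v N.-1],
     so side 0 crosses all the tangents in between. *)
  have dif a b : tangent a q - tangent b q = (a - b) * (q * (a + b) - 2).
    by rewrite /tangent; ring.
  have lo : v i <= 1 \/ 2 <= v i.
    have [h|h] : zigzag_slope 1 i <= 1 \/ 2 <= zigzag_slope 1 i by lia.
      by left; rewrite /v (ler_int _ _ 1).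
    by right; rewrite /v (ler_int _ 2).
  have hi : v N.-1 <= v i /\ v i <= - v N.-1.
    rewrite /v -intrN !ler_int /zigzag_slope /N /= odd_double.
    by move: iN; rewrite /N /=; case: odd; lia.
  rewrite v1 -(subr_ge0 (tangent 1 q)) -(subr_ge0 (tangent (v i) q)) !dif /q.
  by apply/andP; split; [case: lo => ?|case: hi => ? ?]; nra.
move=> [j i]; rewrite finset.in_set /= => ji; split=> // j0.
rewrite vsum -intr_norm (ler_int _ 4) /zigzag_slope.
by case: (boolP (odd i)); case: (boolP (odd j)); lia.
Qed.

Lemma extremal_even m : (1 < m)%N -> exists p : 'I_(m.*2) -> pt, admissible p /\
  forall k, has_card (bounded_components p) k -> (fmax m.*2 <= k)%N.
Proof.
move=> m1; set N := m.*2; have N3 : (3 <= N)%N by rewrite /N; lia.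
pose v k : R := (zigzag_slope N k)%:~R.
(* With this [L] the free ends of the path are [(-1, - L ^+ 2)] and [(1, L ^+ 2)], so side 0 passes
   through the origin. *)
pose L : R := N%:R - 1.
pose closing (x : pt) := x.2 = L ^+ 2 * x.1.
have oN : odd N.-1.
  by rewrite (_ : N.-1 = m.-1.*2.+1)%N /= ?odd_double // /N; lia.
have L2 : 2 <= L.
  have : 3 <= N%:R :> R by rewrite (ler_nat _ 3).
  by rewrite /L => ?; lra.
have v_inj i j : (0 < i < N)%N -> (0 < j < N)%N -> i != j -> v i != v j.
  rewrite /v eqr_int /zigzag_slope /N.
  by case: (boolP (odd i)) => oi; case: (boolP (odd j)) => oj; lia.
have vsum i j : v i + v j = (zigzag_slope N i + zigzag_slope N j)%:~R by rewrite intrD.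
have vb k : (0 < k < N)%N -> - (L - 1) <= v k /\ v k <= L - 1.
  have -> : L - 1 = (N%:Z - 2)%:~R by rewrite /L intrB; lra.
  by rewrite /v -intrN !ler_int /zigzag_slope; case: odd; lia.
have v1 : v 1%N = 1 - L by rewrite /v /zigzag_slope /= intrB /L; lra.
have vN : v N.-1 = L - 1.
  have E : N%:R = N.-1%:R + 1 :> R by rewrite natr1 prednK //; lia.
  rewrite /v /zigzag_slope oN intrB intrM /L /=.
  by rewrite -[N.-1%:~R]/(N.-1%:R : R) -[N%:~R]/(N%:R : R) E; lra.
have q2 : 2^-1 <= (1 : R) by lra.
have sgN : 1 <= (-1 : R) * alternating N.-1 by rewrite /alternating oN mulrNN mulr1.
have v_next k : (0 < k)%N -> (k.+1 < N)%N -> v k + v k.+1 = 2 * alternating k.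
  by move=> _ _; exact: zigzag_slope_next.
have start : on_tangent (v N.-1) (-1) = (-1, - L ^+ 2).
  by rewrite /on_tangent /tangent vN; congr pair; ring.
have stop : on_tangent (v 1%N) 1 = (1, L ^+ 2).
  by rewrite /on_tangent /tangent v1; congr pair; ring.
have closing_side : segment (on_tangent (v N.-1) (-1)) (on_tangent (v 1%N) 1) `<=` closing.
  by rewrite start stop => x [t [_ ->]]; rewrite /closing /=; ring.
(* The tangent of [v k] meets the line of side 0 at abscissa [- 2 * v k / (L ^+ 2 - v k ^+ 2 - 1)];
   its absolute value is at most 1 because [|v k| + 1] is at most [L]. *)
have pos k : (0 < k < N)%N -> 2 * `|v k| <= L ^+ 2 - v k ^+ 2 - 1 /\ 0 < L ^+ 2 - v k ^+ 2 - 1.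
  move=> /vb[h1 h2]; split; last by nra.
  by case: (ler0P (v k)) => h; nra.
have closing_line k (x y : pt) : (0 < k < N)%N -> closing x -> x.2 = tangent (v k) x.1 ->
     closing y -> y.2 = tangent (v k) y.1 -> x = y.
  case: x y => [x1 x2] [y1 y2]; rewrite /closing /tangent /= => /pos[_ D0] -> hx -> hy.
  have D : L ^+ 2 - v k ^+ 2 - 1 != 0 by rewrite gt_eqF.
  by have -> // : x1 = y1 by apply: (mulfI D); lra.
have closing_lines i j (x : pt) : (0 < i < N)%N -> (0 < j < N)%N -> i != j ->
     closing x -> x.2 = tangent (v i) x.1 -> x.2 = tangent (v j) x.1 -> False.
  move=> iN jN ij cx xi xj.
  have := etrans (esym xi) xj => /(tangent_meet _ (v_inj _ _ iN jN ij)).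
  have [h1 h2] := vb i iN; have [h3 h4] := vb j jN.
  move: xi; rewrite cx /tangent; move: (v i) (v j) x.1 h1 h2 h3 h4 => a b u h1 h2 h3 h4 e1 e2.
  (* Eliminating the abscissa gives [L ^+ 2 = 1 - a * b], impossible as [a] and [b] are at most
     [L - 1] in absolute value. *)
  have : L ^+ 2 * ((a + b) * u) = (a ^+ 2 + 1) * ((a + b) * u) - 2 * a * (a + b).
    by rewrite mulrCA e1; ring.
  rewrite e2 => e3.
  suff : 0 < (0 : R) by rewrite ltxx.
  by nra.
exists (zigzag v 1 (-1)); split.
  exact: (zigzag_admissible N3 q2 (lexx 1) (lexx 1) sgN v_next v_inj closing_side closing_line
    closing_lines).
move=> k hk.
pose A := [set ji : 'I_N * 'I_N | (ji.1.+1 < ji.2)%N]%SET.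
(* If [j + i = N] then [v j = - v i] and sides [j] and [i] are parallel. *)
pose B := [set ji : 'I_N * 'I_N | (ji.1.+1 < ji.2)%N && (ji.1 + ji.2 == N)%N]%SET.
have AB : (fmax N <= #|A :\: B|)%N.
  have := cardsD A B; rewrite card_gap_pairs; last by lia.
  have := @card_antidiagonal N m erefl; rewrite -/B.
  have := subset_leq_card (finset.subsetIr A B).
  move: #|A :\: B| #|A :&: B| #|B| => x y z.
  rewrite fmax_even; have : ('C(N.-1, 2) = (2 * m - 1) * (m - 1))%N.
    rewrite bin2 (_ : N.-1 * N.-1.-1 = ((2 * m - 1) * (m - 1)).*2)%N ?doubleK //.
    by rewrite /N; nia.
  by nia.
apply: leq_trans AB _.
apply: (zigzag_components N3 q2 (lexx 1) (lexx 1) sgN v_next v_inj closing_side closing_line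
  closing_lines _ _ hk).
  move=> i /andP[i1 iN]; have [|D1 D0] := pos i; first by lia.
  pose D := L ^+ 2 - v i ^+ 2 - 1; exists (- 2 * v i / D).
    rewrite normrM normfV (gtr0_norm D0) ler_pdivrMr // mul1r normrM normrN.
    by rewrite (ger0_norm (ler0n R 2)).
  set u := - 2 * v i / D.
  have Du : D * u = - 2 * v i by rewrite /u mulrC divfK // gt_eqF.
  have u1 : `|u| <= 1.
    rewrite normrM normfV (gtr0_norm D0) ler_pdivrMr // mul1r normrM normrN.
    by rewrite (ger0_norm (ler0n R 2)).
  move: u1; rewrite ler_norml => /andP[u1 u2].
  exists ((u + 1) / 2); rewrite start stop; split; first by apply/andP; split; lra.
  rewrite /on_tangent /tangent /=; congr pair; first by lra.
  by move: Du; rewrite /D => Du; lra.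
move=> [j i]; rewrite finset.in_setD !finset.in_set /= => /andP[h ji]; split=> // j0.
move: h; rewrite ji /= => h.
by rewrite vsum -intr_norm (ler_int _ 4); exact: zigzag_slope_even.
Qed.

End extremal_curves.

Theorem theorem1 (N : nat) (hN : (3 <= N)%N) :
  (forall p : 'I_N -> pt, admissible p ->
     exists R : nat, has_card (bounded_components p) R /\ (R <= fmax N)%N) /\
  (exists p : 'I_N -> pt, admissible p /\ has_card (bounded_components p) (fmax N)).
Proof.
split; first by move=> p; exact: components_le_fmax.
have [p [adm ge_fmax]] : exists p : 'I_N -> pt, admissible p /\
    forall k, has_card (bounded_components p) k -> (fmax N <= k)%N.
  case: (boolP (odd N)) => oN.
    have [m Nm] : exists m, N = m.*2.+1 by exists N./2; rewrite -{1}[N]odd_double_half oN.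
    by subst N; apply: extremal_odd; lia.
  have [m Nm] : exists m, N = m.*2.
    by exists N./2; rewrite -{1}[N]odd_double_half (negbTE oN).
  by subst N; apply: extremal_even; lia.
(* The upper bound, applied to the extremal curve, also provides the finiteness of its set of
   bounded components. *)
exists p; split=> //; have [k [hk k_le]] := components_le_fmax hN adm.
suff -> : fmax N = k by [].
by apply/eqP; rewrite eqn_leq ge_fmax.
Qed.
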